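(* Let $\lambda>-1$. The mapping $\mathcal{J}:\varphi\mapsto\mathcal{J}(\varphi):=\varphi(\mathbf{K})$ is an isometric isomorphism of the unital $C^*$-algebra $L_\infty(\mathbb{R},E)$ with involution $\varphi\mapsto\overline{\varphi}$ onto a commutative unital subalgebra of $\mathcal{B}(\mathcal{A}^2_\lambda(\Pi))$ with involution $H\mapsto H^*$.
   Context: $\Pi\subset\mathbb{C}$ is the upper half-plane, $z=x+iy$. For $\lambda>-1$, $\mathcal{A}^2_\lambda(\Pi)$ is the weighted Bergman space: the closed subspace of analytic functions in $L_2(\Pi,d\nu_\lambda)$, where $d\nu_\lambda(z)=\frac{\lambda+1}{\pi}(2y)^\lambda dA(z)$ and $dA$ is Lebesgue measure. $\mathcal{B}(\mathcal{A}^2_\lambda(\Pi))$ is the algebra of bounded operators on this space. The operator $\mathbf{K}=\frac1i\frac{\partial}{\partial z}$ acts in $\mathcal{A}^2_\lambda(\Pi)$ on the domain $\mathcal{D}(\mathbf{K})=\{f\in\mathcal{A}^2_\lambda(\Pi):\frac1i f'\in\mathcal{A}^2_\lambda(\Pi)\}$. It is self-adjoint, being unitarily equivalent to multiplication by the independent variable $\xi$ in $L_2(\mathbb{R}_+)$ (Lebesgue measure): $\mathbf{K}=R^*\xi R$, where $R:\mathcal{A}^2_\lambda(\Pi)\to L_2(\mathbb{R}_+)$ is the unitary operator with $(R^*\psi)(z)=\frac{1}{\sqrt{\Gamma(\lambda+2)}}\int_{\mathbb{R}_+}\psi(\xi)\xi^{\frac{\lambda+1}{2}}e^{iz\xi}d\xi$.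 $E$ denotes the spectral measure of $\mathbf{K}$, $E(S)=R^*\chi_SR$ for Borel $S$ ($\chi_S$ the characteristic function), regarded as a measure on $\mathbb{R}$ with $E((-\infty,0])=0$; $\mathbf{E}(\eta)=E((-\infty,\eta))$. A function $\varphi:\mathbb{R}\to\mathbb{C}$ is $E$-measurable if it is measurable with respect to the Stieltjes measure of $\rho_f(\eta)=\langle f,\mathbf{E}(\eta)f\rangle$ for all $f\in\mathcal{A}^2_\lambda(\Pi)$. $L_\infty(\mathbb{R},E)$ is the algebra (with pointwise operations and the $E$-essential supremum norm) of $E$-essentially bounded $E$-measurable functions modulo equality outside sets of zero $E$-measure. The operator $\varphi(\mathbf{K})$ is $\int_{\mathbb{R}}\varphi(\eta)\,d\mathbf{E}(\eta)$. *)

(* Defs.v *)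
From HB Require Import structures.
From mathcomp Require Import all_boot all_order all_algebra.
From mathcomp Require Import complex ring lra.
From mathcomp Require Import all_classical all_reals all_analysis measurable_realfun.

Set Implicit Arguments.
Unset Strict Implicit.
Unset Printing Implicit Defensive.

Import Order.TTheory GRing.Theory Num.Theory.
Import numFieldNormedType.Exports.

Local Open Scope classical_set_scope.
Local Open Scope ring_scope.
Local Open Scope complex_scope.

Local Notation Re := (@complex.Re _).
Local Notation Im := (@complex.Im _).

Section ComplexFunctions.
Context {R : realType}.
Local Notation C := (R[i]).

Definition sqmod (z : C) : R := Re z ^+ 2 + Im z ^+ 2.

Definition cexp (z : C) : C :=
  (expR (Re z))%:C * (cos (Im z) +i* sin (Im z)).

Definition cmeasurable d (T : measurableType d) (D : set T) (f : T -> C) :=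
  measurable_fun D (fun x => Re (f x)) /\ measurable_fun D (fun x => Im (f x)).

Definition cintegral d (T : measurableType d) (mu : {measure set T -> \bar R})
    (D : set T) (f : T -> C) : C :=
  (\int[mu]_(x in D) Re (f x)) +i* (\int[mu]_(x in D) Im (f x)).

(* Meaningful for s > 0 only. *)
Definition Gamma (s : R) : R :=
  \int[lebesgue_measure]_(t in `]0, +oo[) (t `^ (s - 1) * expR (- t)).

End ComplexFunctions.

(* Square-integrable complex functions on D for the measure w dmu. *)
Section WeightedL2.
Context {R : realType} d (T : measurableType d).
Local Notation C := (R[i]).
Variables (mu : {measure set T -> \bar R}) (D : set T) (w : T -> R).

Definition L2fun (f : T -> C) : Prop :=
  cmeasurable D f /\
  mu.-integrable D (fun x => (w x * sqmod (f x))%:E).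

Definition L2dot (f g : T -> C) : C :=
  cintegral mu D (fun x => (w x)%:C * (f x * (g x)^*)).

Hypotheses (mD : measurable D) (mw : measurable_fun D w).

Lemma sqmod_ge0 (z : C) : 0 <= sqmod z.
Proof. by rewrite addr_ge0 ?sqr_ge0. Qed.

Lemma measurable_sqmod (f : T -> C) :
  cmeasurable D f -> measurable_fun D (fun x => sqmod (f x)).
Proof.
by move=> [mr mi]; apply: measurable_funD; apply: measurable_funX.
Qed.

Lemma L2fun0 : L2fun (fun=> 0).
Proof.
split; first by split; exact: measurable_cst.
rewrite (_ : (fun=> _) = cst 0%E); first exact: integrable0.
by apply/funext => x; rewrite /sqmod /= expr0n /= addr0 mulr0.
Qed.

Lemma sqmod_lin (a z t : C) :
  sqmod (a * z + t) <= 2 * sqmod a * sqmod z + 2 * sqmod t.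
Proof.
case: a z t => [a1 a2] [z1 z2] [t1 t2]; rewrite /sqmod /=.
rewrite -subr_ge0.
set u := a1 * z1 - a2 * z2 - t1; set v := a1 * z2 + a2 * z1 - t2.
rewrite [leRHS](_ : _ = u ^+ 2 + v ^+ 2) ?addr_ge0 ?sqr_ge0//.
by rewrite /u /v; ring.
Qed.

Lemma L2fun_lin (a : C) (f g : T -> C) :
  L2fun f -> L2fun g -> L2fun (fun x => a * f x + g x).
Proof.
move=> [mf intf] [mg intg].
have mafg : cmeasurable D (fun x => a * f x + g x).
  case: mf mg => [mfr mfi] [mgr mgi]; split.
    rewrite (_ : (fun x => _) = fun x =>
      Re a * Re (f x) - Im a * Im (f x) + Re (g x)); last first.
      by apply/funext => x; case: (a) (f x) (g x) => [? ?] [? ?] [? ?].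
    apply: measurable_funD => //; apply: measurable_funB;
      by apply: measurable_funM => //; exact: measurable_cst.
  rewrite (_ : (fun x => _) = fun x =>
    Re a * Im (f x) + Im a * Re (f x) + Im (g x)); last first.
    by apply/funext => x; case: (a) (f x) (g x) => [? ?] [? ?] [? ?].
  apply: measurable_funD => //; apply: measurable_funD;
    by apply: measurable_funM => //; exact: measurable_cst.
split => //.
pose h x := 2 * sqmod a * (w x * sqmod (f x)) + 2 * (w x * sqmod (g x)).
apply: (@le_integrable _ _ _ mu D mD _ (EFin \o h)) => //.
- apply/measurable_EFinP/measurable_funM => //; exact: measurable_sqmod.
- move=> x Dx; rewrite /= lee_fin normrM.
  rewrite (_ : h x = w x * (2 * sqmod a * sqmod (f x) + 2 * sqmod (g x))).
    rewrite normrM ler_wpM2l// !ger0_norm ?sqmod_ge0 ?sqmod_lin//.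
    by rewrite addr_ge0 ?mulr_ge0 ?sqmod_ge0 ?ler0n.
  by rewrite /h; ring.
rewrite (_ : EFin \o h = (fun x => (2 * sqmod a)%:E * (w x * sqmod (f x))%:E +
  2%:E * (w x * sqmod (g x))%:E)%E); last first.
  by apply/funext => x; rewrite /h /= EFinD !EFinM.
by apply: integrableD => //; exact: integrableZl.
Qed.

End WeightedL2.

(* A function on the half-line is represented by a function on R, of which
   only the values on ]0, +oo[ matter. *)
Section HalfLine.
Context {R : realType}.
Local Notation C := (R[i]).

Definition half_line : set R := `]0, +oo[.

Definition isL2 (psi : R -> C^o) : Prop :=
  L2fun lebesgue_measure half_line (fun=> 1) psi.

Definition L2_pred : {pred R -> C^o} := fun psi => `[< isL2 psi >].

Lemma L2_submod_closed : submod_closed L2_pred.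
Proof.
split; first by apply/asboolP; exact: L2fun0.
move=> a f g /asboolP fL2 /asboolP gL2; apply/asboolP.
by apply: L2fun_lin => //; exact: measurable_itv.
Qed.

HB.instance Definition _ := GRing.isSubmodClosed.Build _ _ L2_pred
  L2_submod_closed.

End HalfLine.

Record L2 (R : realType) := MkL2 {
  L2val :> R -> R[i]^o ;
  L2valP : L2val \in L2_pred }.

HB.instance Definition _ (R : realType) := [isSub of L2 R for @L2val R].
HB.instance Definition _ (R : realType) := [Choice of L2 R by <:].
HB.instance Definition _ (R : realType) :=
  [SubChoice_isSubLmodule of L2 R by <:].

Section HalfPlane.
Context {R : realType}.
Local Notation C := (R[i]).
Variable lam : R.

Definition half_plane : set (R * R) := [set p | 0 < p.2].

Lemma measurable_half_plane : measurable half_plane.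
Proof.
rewrite (_ : half_plane = setT `*` `]0, +oo[); last first.
  by apply/seteqP; split=> p /=; rewrite in_itv/= ?andbT // => -[].
exact: measurableX.
Qed.

Definition to_C (p : R * R) : C := p.1 +i* p.2.

Definition nu_density (p : R * R) : R := (lam + 1) / pi * (2 * p.2) `^ lam.

Lemma measurable_nu_density D : measurable_fun D nu_density.
Proof.
apply: measurable_funM => //.
apply: (measurableT_comp (measurable_powR _)); apply: measurable_funM => //.
by apply: measurable_funTS; exact: measurable_snd.
Qed.

Definition area : {measure set (measurableTypeR R * measurableTypeR R) -> \bar R} :=
  (lebesgue_measure \x lebesgue_measure)%E.

Definition isA2 (f : C^o -> C^o) : Prop :=
  [/\ forall z : C, 0 < Im z -> derivable f z 1,
      forall z : C, Im z <= 0 -> f z = 0 &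
      L2fun area half_plane nu_density (f \o to_C)].

Definition A2_pred : {pred C^o -> C^o} := fun f => `[< isA2 f >].

Lemma A2_submod_closed : submod_closed A2_pred.
Proof.
split.
  by apply/asboolP; split => //; exact: L2fun0.
move=> a f g /asboolP[df f0 fL2] /asboolP[dg g0 gL2]; apply/asboolP; split.
- by move=> z z0; apply: derivableD; [apply: derivableZ; exact: df|exact: dg].
- by move=> z z0 /=; rewrite !fctE f0// g0// scaler0 addr0.
- by apply: L2fun_lin => //;
    [exact: measurable_half_plane|exact: measurable_nu_density].
Qed.

HB.instance Definition _ := GRing.isSubmodClosed.Build _ _ A2_pred
  A2_submod_closed.

End HalfPlane.

(* The functions of the weighted Bergman space, extended by 0 outside of the
   upper half-plane; this makes equality in A2 the equality of functions. *)
Record A2 (R : realType) (lam : R) := MkA2 {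
  A2val :> R[i]^o -> R[i]^o ;
  A2valP : A2val \in A2_pred lam }.

HB.instance Definition _ (R : realType) (lam : R) :=
  [isSub of A2 lam for @A2val R lam].
HB.instance Definition _ (R : realType) (lam : R) :=
  [Choice of A2 lam by <:].
HB.instance Definition _ (R : realType) (lam : R) :=
  [SubChoice_isSubLmodule of A2 lam by <:].

Section HilbertSpaces.
Context {R : realType}.
Local Notation C := (R[i]).

Definition dotL2 (psi chi : L2 R) : C :=
  L2dot lebesgue_measure half_line (fun=> 1) psi chi.

Definition eqL2 (psi chi : L2 R) : Prop :=
  {ae lebesgue_measure, forall xi : R, half_line xi -> psi xi = chi xi}.

Definition indicL2 (S : set R) (psi : L2 R) : L2 R :=
  insubd (0 : L2 R) (fun xi => (\1_S xi)%:C * psi xi).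

Variable lam : R.

Definition dotA2 (f g : A2 lam) : C :=
  L2dot area half_plane (nu_density lam) (f \o to_C) (g \o to_C).

Definition normA2 (f : A2 lam) : R := Num.sqrt (Re (dotA2 f f)).

(* K_op f g means that f is in the domain of K and that K f = g. *)
Definition K_op (f g : A2 lam) : Prop :=
  forall z : C, 0 < Im z -> g z = 'i^-1 * 'D_1 (f : C^o -> C^o) z.

(* The unitary operator R from A2 onto L2(R_+), its adjoint given by the
   Laplace-type formula RstarE, and the diagonalization K = R^* xi R as an
   equality of unbounded operators.  Elements of L2 are representatives, so
   R R^* = 1 and R K = xi R hold almost everywhere.  RstarE determines the
   operator up to the choice of representatives. *)
Record spectral_rep := SpectralRep {
  Rop : A2 lam -> L2 R ;
  Rstar : {linear L2 R -> A2 lam} ;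
  Rop_adj : forall f psi, dotL2 (Rop f) psi = dotA2 f (Rstar psi) ;
  RstarK : forall f, Rstar (Rop f) = f ;
  RopK : forall psi, eqL2 (Rop (Rstar psi)) psi ;
  RstarE : forall (psi : L2 R) (z : C), 0 < Im z ->
    Rstar psi z = (Num.sqrt (Gamma (lam + 2)))^-1%:C *
      cintegral lebesgue_measure half_line
        (fun xi => psi xi * (xi `^ ((lam + 1) / 2))%:C * cexp ('i * z * xi%:C)) ;
  K_diag : forall f g, K_op f g <->
    {ae lebesgue_measure, forall xi : R, half_line xi ->
      Rop g xi = xi%:C * Rop f xi} }.

End HilbertSpaces.

Section SpectralMeasure.
Context {R : realType}.
Variables (lam : R) (U : spectral_rep lam).
Local Notation C := (R[i]).

Definition specE (S : set R) (f : A2 lam) : A2 lam :=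
  Rstar U (indicL2 S (Rop U f)).

Definition rho (f : A2 lam) (eta : R) : R := Re (dotA2 f (specE `]-oo, eta[ f)).

Lemma indicL2E (S : set R) (psi : L2 R) : measurable S ->
  indicL2 S psi = (fun xi => (\1_S xi)%:C * psi xi) :> (R -> C).
Proof.
move=> mS; rewrite /indicL2 insubdK//.
have /asboolP[[mr mi] ipsi] := L2valP psi.
have m1 : measurable_fun half_line (\1_S : R -> R).
  exact: measurable_indic.
have ReE : (fun xi => Re ((\1_S xi)%:C * psi xi)) =
    (fun xi => \1_S xi * Re (psi xi)).
  by apply/funext => xi; case: (psi xi) => a b /=; rewrite mul0r subr0.
have ImE : (fun xi => Im ((\1_S xi)%:C * psi xi)) =
    (fun xi => \1_S xi * Im (psi xi)).
  by apply/funext => xi; case: (psi xi) => a b /=; rewrite mul0r addr0.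
have mc : cmeasurable half_line (fun xi => (\1_S xi)%:C * psi xi).
  by split; rewrite ?ReE ?ImE; apply: measurable_funM.
apply/asboolP; split=> //; apply: le_integrable ipsi => //.
- exact: measurable_itv.
- apply/measurable_EFinP/measurable_funM => //; exact: measurable_sqmod.
- move=> xi xi0 /=; rewrite lee_fin !mul1r !ger0_norm ?sqmod_ge0//.
  rewrite indicE /sqmod; case: (xi \in S) => /=.
    by case: (psi xi) => a b /=; rewrite !mul0r !mul1r subr0 addr0.
  by case: (psi xi) => a b /=; rewrite !mul0r subr0 addr0 expr0n/= addr0
    addr_ge0 ?sqr_ge0.
Qed.

Lemma rhoE f eta : rho f eta =
  \int[lebesgue_measure]_(xi in half_line)
     (\1_(`]-oo, eta[%classic : set R) xi * sqmod (Rop U f xi)).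
Proof.
rewrite /rho /specE -(Rop_adj U) /dotL2 /L2dot /cintegral /=.
apply: eq_Rintegral => xi _; rewrite indicL2E; last exact: measurable_itv.
by rewrite /sqmod; case: (Rop U f xi) => a b /=; ring.
Qed.

Lemma integrable_sqmodL2 (psi : L2 R) :
  lebesgue_measure.-integrable half_line (EFin \o (fun xi => sqmod (psi xi))).
Proof.
have /asboolP[_] := L2valP psi.
by under eq_fun do rewrite mul1r.
Qed.

Lemma integrable_indic_sqmodL2 (S : set R) (psi : L2 R) : measurable S ->
  lebesgue_measure.-integrable half_line
    (EFin \o (fun xi => \1_S xi * sqmod (psi xi))).
Proof.
move=> mS; apply: le_integrable (integrable_sqmodL2 psi).
- exact: measurable_itv.
- have /asboolP[mpsi _] := L2valP psi.
  apply/measurable_EFinP/measurable_funM; last exact: measurable_sqmod.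
  exact: measurable_indic.
- move=> xi _ /=; rewrite lee_fin normrM ler_piMl// indicE.
  by case: (xi \in S); rewrite ?normr1 ?normr0.
Qed.

Lemma rho_nd f : nondecreasing (rho f).
Proof.
move=> a b ab; rewrite !rhoE; apply: le_Rintegral.
- exact: measurable_itv.
- by apply: integrable_indic_sqmodL2; exact: measurable_itv.
- by apply: integrable_indic_sqmodL2; exact: measurable_itv.
- move=> xi _; rewrite ler_wpM2r ?sqmod_ge0// !indicE.
  rewrite ler_nat; case: (boolP (xi \in _)) => //; rewrite inE/= in_itv/= => xa.
  by rewrite mem_set//= in_itv/= (lt_le_trans xa ab).
Qed.

Let indic_itv_oo (b xi : R) :
  \1_(`]-oo, b[%classic : set R) xi = ((xi < b)%R)%:R :> R.
Proof. by rewrite indicE; congr (_%:R); rewrite mem_setE in_itv. Qed.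

(* rho f is left-continuous by construction; it is also right-continuous
   because E has no atoms, so that the library's Stieltjes measures, built from
   half-open intervals ]a, b], apply to it. *)
Lemma rho_rc f : right_continuous (rho f).
Proof.
move=> a; apply/cvg_at_rightP => u [ua ucv].
pose g (S : set R) xi := (\1_S xi * sqmod (Rop U f xi))%:E.
have gi S : measurable S -> lebesgue_measure.-integrable half_line (g S).
  by move=> mS; exact: integrable_indic_sqmodL2.
have mu n : measurable (`]-oo, u n[%classic : set R) by exact: measurable_itv.
have ma : measurable (`]-oo, a[%classic : set R) by exact: measurable_itv.
have [|||||_ _ cv] := @dominated_convergence _ _ R lebesgue_measure half_line
  (measurable_itv _) (fun n => g `]-oo, u n[%classic) (g `]-oo, a[%classic)
  (fun xi => (sqmod (Rop U f xi))%:E).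
- by move=> n; exact: measurable_int (gi _ (mu n)).
- exact: measurable_int (gi _ ma).
- exists [set a]; split; [exact: measurable_set1|exact: lebesgue_measure_set1|].
  move=> xi /=; apply: contra_notP => xia _.
  have [xila|axi] := ltP xi a.
    apply: cvg_near_cst; apply: nearW => n; rewrite /g.
    by rewrite !indic_itv_oo (lt_trans xila (ua n)) xila.
  have {}axi : a < xi by rewrite lt_neqAle axi andbT; apply/eqP => /esym.
  apply: cvg_near_cst; near=> n; rewrite /g !indic_itv_oo.
  rewrite (lt_gtF axi) lt_gtF//.
  by near: n; exact: (cvgr_lt a ucv).
- exact: integrable_sqmodL2.
- apply: aeW => xi n _; rewrite /g /= lee_fin indic_itv_oo ger0_norm ?mulr_ge0 ?sqmod_ge0//.
  by rewrite ler_piMl ?sqmod_ge0//; case: (xi < _).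
- rewrite rhoE (_ : (fun n => rho f (u n)) =
      fun n => fine (\int[lebesgue_measure]_(x in half_line) g `]-oo, u n[%classic x)).
    apply: fine_cvg; rewrite fineK; first exact: cv.
    by apply: integrable_fin_num (gi _ ma); exact: measurable_itv.
  by apply/funext => n; rewrite rhoE.
Unshelve. all: by end_near. Qed.

HB.instance Definition _ f :=
  isCumulative.Build R _ R (rho f) (@rho_nd f) (@rho_rc f).

End SpectralMeasure.

Section BoundedOperators.
Context {R : realType}.
Variable lam : R.
Local Notation C := (R[i]).
Implicit Types (S T : A2 lam -> A2 lam).

Definition bounded_op T : Prop :=
  linear T /\ exists M : R, forall f, normA2 (T f) <= M * normA2 f.

Definition opnorm T : R :=
  sup [set normA2 (T f) | f in [set f | normA2 f <= 1]].

Definition is_adjoint T S : Prop :=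
  forall f g, dotA2 (T f) g = dotA2 f (S g).

Record commutative_unital_star_subalgebra (B : set (A2 lam -> A2 lam)) : Prop :=
  CommutativeUnitalStarSubalgebra {
    subalg_bounded : forall T, B T -> bounded_op T ;
    subalg_id : B id ;
    subalg_lin : forall (a : C) S T, B S -> B T -> B (a *: S + T) ;
    subalg_comp : forall S T, B S -> B T -> B (S \o T) ;
    subalg_comm : forall S T, B S -> B T -> S \o T = T \o S ;
    subalg_adj : forall T, B T -> exists2 S, B S & is_adjoint T S }.

End BoundedOperators.

Section FunctionAlgebras.
Context {R : realType}.
Local Notation C := (R[i]).

Definition conjf (X : Type) (phi : X -> C) : X -> C := fun x => (phi x)^*.

(* The classes modulo eqv of the functions of A form, under pointwise
   operations and complex conjugation, a unital C*-algebra with norm N. *)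
Record unital_Cstar_algebra (X : Type) (A : set (X -> C))
    (eqv : (X -> C) -> (X -> C) -> Prop) (N : (X -> C) -> R) : Prop :=
  UnitalCstarAlgebra {
    Cstar_one : A 1 ;
    Cstar_lin : forall (a : C) phi psi, A phi -> A psi -> A (a *: phi + psi) ;
    Cstar_mul : forall phi psi, A phi -> A psi -> A (phi * psi) ;
    Cstar_conj : forall phi, A phi -> A (conjf phi) ;
    Cstar_ge0 : forall phi, A phi -> 0 <= N phi ;
    Cstar_eq : forall phi psi, A phi -> A psi ->
      eqv phi psi <-> N (phi - psi) = 0 ;
    Cstar_scale : forall (a : C) phi, A phi ->
      N (a *: phi) = Normc.normc a * N phi ;
    Cstar_triangle : forall phi psi, A phi -> A psi ->
      N (phi + psi) <= N phi + N psi ;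
    Cstar_submul : forall phi psi, A phi -> A psi ->
      N (phi * psi) <= N phi * N psi ;
    Cstar_identity : forall phi, A phi -> N (conjf phi * phi) = N phi ^+ 2 ;
    Cstar_complete : forall u : nat -> X -> C, (forall n, A (u n)) ->
      (forall e : R, 0 < e -> exists n0 : nat, forall m n : nat,
        (n0 <= m)%N -> (n0 <= n)%N -> N (u m - u n) < e) ->
      exists2 phi, A phi & N (u n - phi) @[n --> \oo] --> (0 : R) }.

End FunctionAlgebras.

Section FunctionalCalculus.
Context {R : realType}.
Variables (lam : R) (U : spectral_rep lam).
Local Notation C := (R[i]).
Implicit Types (phi psi : R -> C) (f g : A2 lam).

(* R with the sigma-algebra completed for the Stieltjes measure of rho f. *)
Definition rho_type f := caratheodory_type (wlength (rho U f))^*%mu.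

Definition E_measurable phi : Prop :=
  forall f, cmeasurable (setT : set (rho_type f)) phi.

(* The values of E on non-Borel sets are not defined by specE, hence the Borel
   cover. *)
Definition E_null (N : set R) : Prop :=
  exists S : set R,
    [/\ measurable S, N `<=` S & forall f, specE U S f = 0].

Definition E_ae_eq phi psi : Prop := E_null [set eta | phi eta <> psi eta].

Definition E_bound phi : set R :=
  [set M | 0 <= M /\ E_null [set eta | M < Normc.normc (phi eta)]].

Definition Linfty : set (R -> C) :=
  [set phi | E_measurable phi /\ E_bound phi !=set0].

Definition E_norm phi : R := inf (E_bound phi).

Definition int_rho phi f : C :=
  cintegral (completed_lebesgue_stieltjes_measure (rho U f)) setT phi.

(* The integral of phi for the complex measure S |-> <E(S) f, g>, which the
   polarization identity writes in terms of the measures of the rho h. *)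
Definition int_E phi f g : C :=
  4%:R^-1 * \sum_(k < 4) 'i ^+ k * int_rho phi (f + 'i ^+ k *: g).

(* phi(K) is the bounded operator T with <T f, g> = \int phi d<E f, g>. *)
Definition funcK phi : A2 lam -> A2 lam :=
  xget (fun=> 0)
    [set T | bounded_op T /\ forall f g, dotA2 (T f) g = int_E phi f g].

Record isometric_star_isomorphism_on
    (J : (R -> C) -> A2 lam -> A2 lam) : Prop := IsometricStarIsomorphism {
  iso_bounded : forall phi, Linfty phi -> bounded_op (J phi) ;
  iso_eq : forall phi psi, Linfty phi -> Linfty psi ->
    E_ae_eq phi psi <-> J phi = J psi ;
  iso_one : J 1 = id ;
  iso_lin : forall (a : C) phi psi, Linfty phi -> Linfty psi ->
    J (a *: phi + psi) = a *: J phi + J psi ;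
  iso_mul : forall phi psi, Linfty phi -> Linfty psi ->
    J (phi * psi) = J phi \o J psi ;
  iso_conj : forall phi, Linfty phi -> is_adjoint (J phi) (J (conjf phi)) ;
  iso_norm : forall phi, Linfty phi -> opnorm (J phi) = E_norm phi }.

End FunctionalCalculus.

(* Main.v *)
Require Import Defs.
From HB Require Import structures.
From mathcomp Require Import all_boot all_order all_algebra.
From mathcomp Require Import complex ring lra.
From mathcomp Require Import all_classical all_reals all_analysis measurable_realfun.
Import Order.TTheory GRing.Theory Num.Theory.
Import numFieldNormedType.Exports.

(* Under the unitary operator R, phi(K) becomes multiplication by phi on
   L2(R_+).  The E-null sets are the sets whose trace on the half-line is
   Lebesgue-null: the inverse image f0 under R of the nowhere vanishing function
   exp(- xi) has a spectral measure equivalent to Lebesgue measure on R_+.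
   Hence measurability for the completed measure of rho f0 alone already gives
   every phi in L_infty a bounded Borel representative p; the Stieltjes measure
   of rho f has the density |R f|^2, so the quadratic form of phi(K) at f is
   the integral of p |R f|^2, and polarization identifies phi(K) with
   R^* p R.  The algebraic identities are then pointwise, and the
   operator norm is the essential supremum by testing on R^* (chi_S exp(- xi))
   with S = {|p| > c}. *)

Set Implicit Arguments.
Unset Strict Implicit.
Unset Printing Implicit Defensive.

Local Open Scope classical_set_scope.
Local Open Scope ring_scope.
Local Open Scope complex_scope.
Local Notation Re := (@complex.Re _).
Local Notation Im := (@complex.Im _).
Local Notation normc := Normc.normc.

(** * Complex numbers and complex integrals *)

(** Two gaps separate the definitions from multiplication operators. Elements of [L2] are
    representatives while elements of [A2] are functions, so [Rop] is linear, and [Rop (Rstar psi)]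
    equals [psi], only up to null sets. The integral formula for [Rstar] does not see null sets, so
    an identity that holds almost everywhere on the half-line still becomes an equality in [A2]. The
    other gap is measurability: a member of [Linfty] is measurable only for the completions of the
    measures of the [rho f], one for each f, and uncountably many exceptional sets cannot be united.
    One vector whose density vanishes nowhere on the half-line suffices, because the measures of all
    other vectors are absolutely continuous with respect to its own. *)

Section ComplexNumbers.
Context {R : realType}.
Local Notation C := (R[i]).
Implicit Types z w : C.

Lemma normc_sqmod z : normc z = Num.sqrt (sqmod z).
Proof. by case: z. Qed.

Lemma sqmod_normc z : sqmod z = normc z ^+ 2.
Proof. by rewrite normc_sqmod sqr_sqrtr// sqmod_ge0. Qed.

Lemma normc_ge0 z : 0 <= normc z.
Proof. by rewrite normc_sqmod sqrtr_ge0. Qed.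

Lemma ler_normcD z w : normc (z + w) <= normc z + normc w.
Proof. exact: le_normcD. Qed.

Lemma normcB z w : normc (z - w) = normc (w - z).
Proof. by rewrite -(normcN (z - w)) opprB. Qed.

Lemma normc_conj z : normc z^* = normc z.
Proof. by rewrite !normc_sqmod; case: z => a b; rewrite /sqmod /= sqrrN. Qed.

Lemma sqmodM z w : sqmod (z * w) = sqmod z * sqmod w.
Proof. by rewrite !sqmod_normc Normc.normcM exprMn. Qed.

Lemma sqmod_eq0 z : (sqmod z == 0) = (z == 0).
Proof. by case: z => a b; rewrite /sqmod paddr_eq0 ?sqr_ge0// !sqrf_eq0 eq_complex. Qed.

Lemma mul_conj_sqmod z : z * z^* = (sqmod z)%:C.
Proof.
case: z => a b; apply/eqP; rewrite /sqmod eq_complex /=.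
by apply/andP; split; apply/eqP; ring.
Qed.

(* [_^*] denotes [Num.conj] in factors of a product, where the scope of rings
   comes first, and [conjc] elsewhere. *)
Lemma conjc_mulconj z w : (z * w^*)^* = w * z^*.
Proof.
case: z w => a b [c e]; apply/eqP; rewrite eq_complex /=.
by apply/andP; split; apply/eqP; ring.
Qed.

Lemma conjc_mul_mulconj (c : C) z w :
  conjc (conjc c * (z * w^*)) = c * (w * z^*).
Proof. by rewrite rmorphM /= conjcK conjc_mulconj. Qed.

Lemma normr_Re z : `|Re z| <= normc z.
Proof.
by rewrite normc_sqmod -sqrtr_sqr ler_sqrt ?sqmod_ge0// lerDl sqr_ge0.
Qed.

Lemma normr_Im z : `|Im z| <= normc z.
Proof.
by rewrite normc_sqmod -sqrtr_sqr ler_sqrt ?sqmod_ge0// lerDr sqr_ge0.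
Qed.

Lemma normc_le z : normc z <= `|Re z| + `|Im z|.
Proof.
rewrite normc_sqmod -[leRHS]ger0_norm ?addr_ge0// -sqrtr_sqr ler_sqrt ?sqr_ge0//.
by rewrite sqrrD !real_normK ?num_real// /sqmod lerD2r lerDl mulrn_wge0// mulr_ge0.
Qed.

(** A crude form of Young's inequality; it makes the product of two square-integrable functions
    integrable. *)
Lemma normc_mulconj_le z w : normc (z * w^*) <= sqmod z + sqmod w.
Proof.
rewrite Normc.normcM normc_conj !sqmod_normc.
by have := normc_ge0 z; have := normc_ge0 w; nra.
Qed.

End ComplexNumbers.

Section ComplexMeasurability.
Context {R : realType} d (T : measurableType d).
Local Notation C := (R[i]).
Implicit Types (D : set T) (f g : T -> C).

Lemma cmeasurable_cst D (c : C) : cmeasurable D (fun=> c).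
Proof. by split; exact: measurable_cst. Qed.

Lemma cmeasurable_real D (h : T -> R) :
  measurable_fun D h -> cmeasurable D (fun x => (h x)%:C).
Proof. by split => //=; exact: measurable_cst. Qed.

Lemma cmeasurableD D f g :
  cmeasurable D f -> cmeasurable D g -> cmeasurable D (fun x => f x + g x).
Proof.
move=> [fr fi] [gr gi]; split; under eq_fun do rewrite raddfD/=;
  exact: measurable_funD.
Qed.

Lemma cmeasurableM D f g :
  cmeasurable D f -> cmeasurable D g -> cmeasurable D (fun x => f x * g x).
Proof.
move=> [fr fi] [gr gi]; split.
  rewrite (_ : (fun x => _) = fun x => Re (f x) * Re (g x) - Im (f x) * Im (g x)).
    by apply: measurable_funB; apply: measurable_funM.
  by apply/funext => x; case: (f x) (g x) => [? ?] [? ?].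
rewrite (_ : (fun x => _) = fun x => Re (f x) * Im (g x) + Im (f x) * Re (g x)).
  by apply: measurable_funD; apply: measurable_funM.
by apply/funext => x; case: (f x) (g x) => [? ?] [? ?].
Qed.

Lemma cmeasurable_conj D f : cmeasurable D f -> cmeasurable D (conjf f).
Proof.
move=> [fr fi]; split.
  by rewrite (_ : (fun x => _) = fun x => Re (f x))//; apply/funext => x;
    rewrite /conjf; case: (f x).
rewrite (_ : (fun x => _) = fun x => - Im (f x)); first exact: measurable_funN.
by apply/funext => x; rewrite /conjf; case: (f x).
Qed.

Lemma cmeasurable_normc D f :
  cmeasurable D f -> measurable_fun D (fun x => normc (f x)).
Proof.
move=> mf; under eq_fun do rewrite normc_sqmod.
apply: measurableT_comp; last exact: measurable_sqmod.
by apply: continuous_measurable_fun; exact: sqrt_continuous.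
Qed.

End ComplexMeasurability.

(** An upper bound is what [mult_op_norm_null] can supply. Integrability guarantees that the real
    integral is not a truncated infinite one. *)
Lemma ge0_Rintegral_eq0 {R : realType} d (T : measurableType d)
    (mu : {measure set T -> \bar R}) (D : set T) (h : T -> R) :
  measurable D -> mu.-integrable D (EFin \o h) -> (forall x, D x -> 0 <= h x) ->
  \int[mu]_(x in D) h x <= 0 -> mu.-negligible [set x | D x /\ h x <> 0].
Proof.
move=> mD ih h0 ih0.
have : ae_eq mu D (EFin \o h) (cst 0%E).
  apply/ae_eq_integral_abs => //; first exact: measurable_int ih.
  rewrite (eq_integral (EFin \o h)); last first.
    by move=> x /set_mem Dx /=; rewrite ger0_norm ?h0.
  rewrite -[LHS]fineK; last exact: integrable_fin_num ih.
  congr (_%:E); apply/eqP; rewrite eq_le; apply/andP; split => //.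
  exact: Rintegral_ge0.
by apply: negligibleS => x /= [Dx hx] /(_ Dx)[].
Qed.

Section ComplexIntegral.
Context {R : realType} d (T : measurableType d).
Local Notation C := (R[i]).
Variables (mu : {measure set T -> \bar R}) (D : set T).
Hypothesis mD : measurable D.
Implicit Types f g : T -> C.

Definition cintegrable f := mu.-integrable D (EFin \o (fun x => Re (f x))) /\
  mu.-integrable D (EFin \o (fun x => Im (f x))).

Lemma le_cintegrable f (h : T -> R) : cmeasurable D f ->
  mu.-integrable D (EFin \o h) -> (forall x, D x -> normc (f x) <= h x) ->
  cintegrable f.
Proof.
move=> [mr mi] ih fh; split; apply: (le_integrable mD _ _ ih).
- exact/measurable_EFinP.
- move=> x Dx; rewrite /= lee_fin.
  by rewrite (le_trans (normr_Re _))// (le_trans (fh _ Dx))// ler_norm.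
- exact/measurable_EFinP.
- move=> x Dx; rewrite /= lee_fin.
  by rewrite (le_trans (normr_Im _))// (le_trans (fh _ Dx))// ler_norm.
Qed.

Lemma cintegralD f g : cintegrable f -> cintegrable g ->
  cintegral mu D (fun x => f x + g x) = cintegral mu D f + cintegral mu D g.
Proof.
move=> [fr fi] [gr gi]; rewrite /cintegral.
under [X in X +i* _]eq_Rintegral do rewrite raddfD/=.
under [X in _ +i* X]eq_Rintegral do rewrite raddfD/=.
by rewrite !RintegralD.
Qed.

Lemma cintegralZ (c : C) f : cintegrable f ->
  cintegral mu D (fun x => c * f x) = c * cintegral mu D f.
Proof.
case: c => a b [fr fi]; rewrite /cintegral.
have sc (k : R) (h : T -> R) : mu.-integrable D (EFin \o h) ->
    mu.-integrable D (EFin \o (fun x => k * h x)).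
  by move=> ih; apply: (integrableZl mD k) ih.
transitivity ((\int[mu]_(x in D) (a * Re (f x) - b * Im (f x))) +i*
              (\int[mu]_(x in D) (a * Im (f x) + b * Re (f x)))).
  by congr (_ +i* _); apply: eq_Rintegral => x _; case: (f x).
by rewrite RintegralB ?RintegralD ?RintegralZl//; exact: sc.
Qed.

Lemma cintegral_conj f : cintegrable f ->
  cintegral mu D (conjf f) = (cintegral mu D f)^*.
Proof.
move=> [fr fi]; rewrite /cintegral /=; congr (_ +i* _).
  by apply: eq_Rintegral => x _; rewrite /conjf; case: (f x).
rewrite -mulN1r -RintegralZl//.
by apply: eq_Rintegral => x _; rewrite /conjf mulN1r; case: (f x).
Qed.

Lemma eq_cintegral f g : {in D, f =1 g} -> cintegral mu D f = cintegral mu D g.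
Proof.
by move=> fg; congr (_ +i* _); apply: eq_Rintegral => x xD; rewrite fg.
Qed.

Lemma ae_eq_cintegral f g : cmeasurable D f -> cmeasurable D g ->
  {ae mu, forall x, D x -> f x = g x} -> cintegral mu D f = cintegral mu D g.
Proof.
move=> [fr fi] [gr gi] fg; rewrite /cintegral /Rintegral.
congr (fine _ +i* fine _); apply: ae_eq_integral => //;
  try exact/measurable_EFinP; by apply: filterS fg => x /[apply] ->.
Qed.

End ComplexIntegral.

(** * Square-integrable functions on the half-line *)

Section SquareIntegrable.
Context {R : realType}.
Local Notation C := (R[i]).
Local Notation leb := (@lebesgue_measure R).
Implicit Types (p q : R -> C) (F G H : L2 R).

Let mH : measurable (half_line : set (measurableTypeR R)).
Proof. exact: measurable_itv. Qed.

Lemma L2_measurable F :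
  cmeasurable (half_line : set (measurableTypeR R)) F.
Proof. by have /asboolP[] := L2valP F. Qed.

Lemma isL2P (psi : R -> C) : isL2 psi <-> cmeasurable half_line psi /\
  leb.-integrable half_line (EFin \o (fun x => sqmod (psi x))).
Proof. by rewrite /isL2 /L2fun; under eq_fun do rewrite mul1r. Qed.

Lemma mkL2 (psi : R -> C) : isL2 psi -> {F : L2 R | F = psi :> (R -> C)}.
Proof. by move=> psiP; exists (MkL2 (asboolT psiP)). Qed.

Lemma L2_cintegrable F G : cintegrable leb half_line (fun x => F x * (G x)^*).
Proof.
apply: (@le_cintegrable _ _ _ _ _ mH _ (fun x => sqmod (F x) + sqmod (G x))).
- by apply: cmeasurableM; [|apply: cmeasurable_conj]; exact: L2_measurable.
- exact: (integrableD mH (integrable_sqmodL2 F) (integrable_sqmodL2 G)).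
- by move=> x _; exact: normc_mulconj_le.
Qed.

Lemma dotL2E F G :
  dotL2 F G = cintegral leb half_line (fun x => F x * (G x)^*).
Proof. by apply: eq_cintegral => x _; rewrite mul1r. Qed.

Lemma dotL2_sqmod F :
  dotL2 F F = (\int[leb]_(x in half_line) sqmod (F x))%:C.
Proof.
rewrite dotL2E /cintegral; under eq_Rintegral do rewrite mul_conj_sqmod.
under [X in _ +i* X]eq_Rintegral do rewrite mul_conj_sqmod /=.
by rewrite (Rintegral_cst leb mH) mul0r.
Qed.

Lemma dotL2_lin (a : C) F G H : dotL2 (a *: F + G) H = a * dotL2 F H + dotL2 G H.
Proof.
have [? ?] := (L2_cintegrable F H, L2_cintegrable G H).
rewrite !dotL2E -cintegralZ// -cintegralD//; last first.
  rewrite (_ : (fun x => _) = (fun x => ((a *: F : L2 R) x) * (H x)^*)).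
    exact: L2_cintegrable.
  by apply/funext => x; exact: mulrA.
apply: eq_cintegral => x _.
(* The operations of [L2] are pointwise by conversion; the annotations turn the scaling of [C^o]
   into a product in [C]. *)
transitivity ((a * (F x : C) + (G x : C)) * (H x : C)^*); first by [].
by rewrite mulrDl -mulrA.
Qed.

Lemma dotL2C F G : dotL2 G F = (dotL2 F G)^*.
Proof.
rewrite !dotL2E -cintegral_conj//; last exact: L2_cintegrable.
by apply: eq_cintegral => x _; rewrite /conjf conjc_mulconj.
Qed.

Lemma eq_dotL2 F F' G : eqL2 F F' -> dotL2 F G = dotL2 F' G.
Proof.
move=> FF'; rewrite !dotL2E; apply: ae_eq_cintegral => //.
- by apply: cmeasurableM; [|apply: cmeasurable_conj]; exact: L2_measurable.
- by apply: cmeasurableM; [|apply: cmeasurable_conj]; exact: L2_measurable.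
- by apply: negligibleS FF' => x /=; apply: contra_not => + Hx => ->.
Qed.

(** The bound holds at every point, so sums and products of such functions involve no exceptional
    sets. *)
Definition bounded_borel p := cmeasurable (setT : set R) p /\
  exists M : R, forall x, normc (p x) <= M.

Lemma bounded_borel_cst (c : C) : bounded_borel (fun=> c).
Proof. by split; [exact: cmeasurable_cst|exists (normc c)]. Qed.

Lemma bounded_borel_lin (a : C) p q :
  bounded_borel p -> bounded_borel q -> bounded_borel (a *: p + q).
Proof.
move=> [mp [M pM]] [mq [N qN]]; split.
  by apply: cmeasurableD => //; apply: cmeasurableM => //; exact: cmeasurable_cst.
exists (normc a * M + N) => x; rewrite (le_trans (ler_normcD _ _))// lerD//.
by rewrite Normc.normcM ler_wpM2l ?normc_ge0.
Qed.

Lemma bounded_borelM p q :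
  bounded_borel p -> bounded_borel q -> bounded_borel (p * q).
Proof.
move=> [mp [M pM]] [mq [N qN]]; split; first exact: cmeasurableM.
by exists (M * N) => x; rewrite Normc.normcM ler_pM ?normc_ge0.
Qed.

Lemma bounded_borel_conj p : bounded_borel p -> bounded_borel (conjf p).
Proof.
move=> [mp [M pM]]; split; first exact: cmeasurable_conj.
by exists M => x; rewrite normc_conj.
Qed.

Lemma isL2_mul p F : bounded_borel p -> isL2 (fun x => p x * F x).
Proof.
move=> [[mpr mpi] [M pM]].
have mpF : cmeasurable half_line (fun x => p x * F x).
  apply: cmeasurableM; last exact: L2_measurable.
  by split; apply: measurable_funTS.
apply/isL2P; split=> //.
apply: (le_integrable mH _ _
  (integrableZl mH (M ^+ 2) (integrable_sqmodL2 F))).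
  exact/measurable_EFinP/measurable_sqmod.
move=> x _ /=; rewrite lee_fin !ger0_norm ?sqmod_ge0//; last first.
  by rewrite mulr_ge0 ?sqr_ge0 ?sqmod_ge0.
by rewrite sqmodM ler_wpM2r ?sqmod_ge0// sqmod_normc lerXn2r ?nnegrE ?normc_ge0//
  (le_trans (normc_ge0 _) (pM x)).
Qed.

(** The default 0 keeps proofs of boundedness out of the term. For an indicator this is [indicL2] by
    conversion, which [E_nullE] exploits. *)
Definition mulL2 p F : L2 R := insubd (0 : L2 R) (fun x => p x * F x).

Lemma mulL2E p F : bounded_borel p -> mulL2 p F = (fun x => p x * F x) :> (R -> C).
Proof. by move=> pB; rewrite /mulL2 insubdK//; apply/asboolP/isL2_mul. Qed.

Lemma ae_eqL2P F G :
  eqL2 F G <-> leb.-negligible [set x | half_line x /\ F x <> G x].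
Proof.
split; apply: negligibleS => x /=.
  by move=> [Hx FG] /(_ Hx).
by apply: contra_notP => /not_andP[//|/contrapT].
Qed.

End SquareIntegrable.

(** * Transfer to the Bergman space *)

Section Transfer.
Context {R : realType}.
Local Notation C := (R[i]).
Local Notation leb := (@lebesgue_measure R).
Local Notation TR := (measurableTypeR R).

Lemma cmeasurable_cexp (D : set TR) (h : R -> C) :
  cmeasurable D h -> cmeasurable D (fun x => cexp (h x)).
Proof.
move=> [hr hi]; apply: cmeasurableM.
  by apply: cmeasurable_real; apply: measurableT_comp => //; exact: measurable_expR.
split => /=.
  by apply: (measurableT_comp (continuous_measurable_fun _)) hi; exact: continuous_cos.
by apply: (measurableT_comp (continuous_measurable_fun _)) hi; exact: continuous_sin.
Qed.

Lemma eqL2_trans (F G H : L2 R) : eqL2 F G -> eqL2 G H -> eqL2 F H.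
Proof.
move=> /ae_eqL2P FG /ae_eqL2P GH; apply/ae_eqL2P.
apply: negligibleS (negligibleU FG GH) => x /= [Hx FH].
by have [E|?] := pselect (F x = G x); [right; rewrite -E|left].
Qed.

Lemma eqL2_sym (F G : L2 R) : eqL2 F G -> eqL2 G F.
Proof.
move=> /ae_eqL2P FG; apply/ae_eqL2P; apply: negligibleS FG => x /= [Hx ?].
by split=> // /esym.
Qed.

Lemma eqL2_mul (p q : R -> C) (F G : L2 R) : bounded_borel p -> bounded_borel q ->
  leb.-negligible [set x | half_line x /\ p x <> q x] -> eqL2 F G ->
  eqL2 (mulL2 p F) (mulL2 q G).
Proof.
move=> pB qB pq /ae_eqL2P FG; apply/ae_eqL2P.
apply: negligibleS (negligibleU pq FG) => x /= [Hx].
rewrite !mulL2E// => FH.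
have [E|?] := pselect (p x = q x); last by left.
by right; split=> // FGx; apply: FH; rewrite E FGx.
Qed.

Lemma eqL2_mulr (p : R -> C) (F G : L2 R) : bounded_borel p -> eqL2 F G ->
  eqL2 (mulL2 p F) (mulL2 p G).
Proof.
move=> pB; apply: eqL2_mul => //; rewrite (_ : [set _ | _] = set0).
  exact: negligible_set0.
by apply/seteqP; split=> x // -[].
Qed.

Variables (lam : R) (U : spectral_rep lam).
Implicit Types (f g h : A2 lam) (F G : L2 R).

Lemma dotA2E f g : dotA2 f g = dotL2 (Rop U f) (Rop U g).
Proof. by rewrite Rop_adj RstarK. Qed.

Lemma dotA2_sqmod f :
  dotA2 f f = (\int[leb]_(x in half_line) sqmod (Rop U f x))%:C.
Proof. by rewrite dotA2E dotL2_sqmod. Qed.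

Lemma normA2_ge0 f : 0 <= normA2 f.
Proof. exact: sqrtr_ge0. Qed.

Lemma sqr_normA2 f :
  normA2 f ^+ 2 = \int[leb]_(x in half_line) sqmod (Rop U f x).
Proof.
rewrite /normA2 dotA2_sqmod sqr_sqrtr//.
by apply: Rintegral_ge0 => x _; exact: sqmod_ge0.
Qed.

Lemma A2_ext f g : (forall z : C, 0 < Im z -> f z = g z) -> f = g.
Proof.
move=> fg; apply/val_inj/funext => z /=; have [/fg//|z0] := ltP 0 (Im z).
have /asboolP[_ f0 _] := A2valP f; have /asboolP[_ g0 _] := A2valP g.
by rewrite f0 ?g0.
Qed.

(** By [RstarE] each value on the half-plane is an integral over the half-line, and changing the
    integrand on a null set does not affect it. *)
Lemma Rstar_ae F G : eqL2 F G -> Rstar U F = Rstar U G.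
Proof.
move=> FG; apply: A2_ext => z z0; rewrite !RstarE//; congr (_ * _).
have mk (H : L2 R) : cmeasurable (half_line : set TR)
    (fun xi => H xi * (xi `^ ((lam + 1) / 2))%:C * cexp ('i * z * xi%:C)).
  apply: cmeasurableM.
    apply: cmeasurableM; first exact: L2_measurable.
    by apply: cmeasurable_real; apply: measurable_funTS; exact: measurable_powR.
  apply: cmeasurable_cexp; apply: cmeasurableM; first exact: cmeasurable_cst.
  by apply: cmeasurable_real; exact: measurable_id.
apply: ae_eq_cintegral; [exact: measurable_itv|exact: mk|exact: mk|].
by apply: negligibleS FG => x /=; apply: contra_not => + Hx => ->.
Qed.

(** The record does not postulate that [Rop] is linear; this follows from the linearity of its
    inverse [Rstar]. *)
Lemma Rop_lin (a : C) f g :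
  eqL2 (Rop U (a *: f + g)) (a *: Rop U f + Rop U g).
Proof.
have -> : a *: f + g = Rstar U (a *: Rop U f + Rop U g).
  by rewrite linearP !RstarK.
exact: RopK.
Qed.

Lemma dotA2_lin (a : C) f g h : dotA2 (a *: f + g) h = a * dotA2 f h + dotA2 g h.
Proof. by rewrite !dotA2E (eq_dotL2 _ (Rop_lin a f g)) dotL2_lin. Qed.

Lemma dotA2C f g : dotA2 g f = (dotA2 f g)^*.
Proof. by rewrite !dotA2E dotL2C. Qed.

(** Definiteness is read off on the half-line: [Rop U f] vanishes almost everywhere, and [f] is
    recovered from it by [Rstar]. *)
Lemma dotA2_eq0 f : dotA2 f f = 0 -> f = 0.
Proof.
rewrite dotA2_sqmod => /(congr1 Re) /= f0.
have N : leb.-negligible [set x | half_line x /\ sqmod (Rop U f x) <> 0].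
  apply: (ge0_Rintegral_eq0 _ (integrable_sqmodL2 (Rop U f))).
  - exact: measurable_itv.
  - by move=> x _; exact: sqmod_ge0.
  - by rewrite f0.
rewrite -[LHS](RstarK U) -(linear0 (Rstar U)); apply: Rstar_ae; apply/ae_eqL2P.
by apply: negligibleS N => x /= [Hx fx]; split=> // /eqP;
  rewrite sqmod_eq0 => /eqP.
Qed.

Lemma dotA2_inj f g : (forall h, dotA2 f h = dotA2 g h) -> f = g.
Proof.
move=> fg; apply/eqP; rewrite -subr_eq0; apply/eqP/dotA2_eq0.
have -> : f - g = -1 *: g + f by rewrite scaleN1r addrC.
by rewrite dotA2_lin fg mulN1r addNr.
Qed.

End Transfer.

(** * Multiplication operators carried over to the Bergman space *)

Section MultiplicationOperator.
Context {R : realType}.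
Local Notation C := (R[i]).
Local Notation leb := (@lebesgue_measure R).
Local Notation TR := (measurableTypeR R).
Implicit Types (p q : R -> C) (F G : L2 R).

Lemma eqL2_sqmod F G : eqL2 F G ->
  \int[leb]_(x in half_line) sqmod (F x) = \int[leb]_(x in half_line) sqmod (G x).
Proof.
(* [eq_dotL2] replaces a first argument only; conjugate symmetry brings the second one into that
   place. *)
move=> FG; have := eq_dotL2 F FG.
by rewrite (dotL2C F G) (eq_dotL2 G FG) !dotL2_sqmod => /(congr1 Re).
Qed.

(* Any square-integrable function without zeros on the half-line would do. *)
Definition exp_decay (x : R) : C := (expR (- x))%:C.

Lemma isL2_exp_decay : isL2 exp_decay.
Proof.
have mH : measurable (half_line : set TR) by exact: measurable_itv.
have me : cmeasurable (half_line : set TR) exp_decay.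
  apply: cmeasurable_real; apply: measurableT_comp; first exact: measurable_expR.
  by apply: measurable_funTS; exact: measurable_funN.
apply/isL2P; split => //.
(* The majorant is the exponential density of rate 1, since exp(- 2 x) is at most exp(- x) for x >
   0. *)
have ie := integrableS measurableT mH (@subsetT _ _)
  (integrable_exponential_pdf (ltr01 : 0 < 1 :> R)).
apply: (le_integrable mH _ _ ie).
  exact/measurable_EFinP/measurable_sqmod.
move=> x; rewrite /half_line /= in_itv /= andbT => x0.
rewrite exponential_pdfE; last exact: ltW.
rewrite mul1r mulN1r.
rewrite lee_fin !ger0_norm ?expR_ge0 ?sqmod_ge0//.
rewrite /sqmod /exp_decay /= expr0n /= addr0 expr2 ler_piMl ?expR_ge0//.
by rewrite -expR0 ler_expR oppr_le0 ltW.
Qed.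

Lemma bounded_borel_indic (S : set TR) : measurable S ->
  bounded_borel (fun x => (\1_S x : R)%:C).
Proof.
move=> mS; split; first by apply: cmeasurable_real; exact: measurable_indic.
exists 1 => x; rewrite normc_sqmod /sqmod /= expr0n /= addr0 sqrtr_sqr.
by rewrite indicE; case: (_ \in _); rewrite ?normr1 ?normr0.
Qed.

Variables (lam : R) (U : spectral_rep lam).
Implicit Types (f g : A2 lam).

Definition mult_op p f : A2 lam := Rstar U (mulL2 p (Rop U f)).

Lemma Rop_mult_op p f : eqL2 (Rop U (mult_op p f)) (mulL2 p (Rop U f)).
Proof. exact: RopK. Qed.

Lemma dotA2_mult_op p f g : bounded_borel p -> dotA2 (mult_op p f) g =
  cintegral leb half_line (fun x => p x * (Rop U f x * (Rop U g x)^*)).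
Proof.
move=> pB; rewrite (dotA2E U) (eq_dotL2 _ (Rop_mult_op p f)) dotL2E mulL2E//.
by apply: eq_cintegral => x _; rewrite mulrA.
Qed.

Lemma mult_op_ae p q : bounded_borel p -> bounded_borel q ->
  leb.-negligible [set x | half_line x /\ p x <> q x] -> mult_op p = mult_op q.
Proof.
move=> pB qB pq; apply/funext => f; apply: Rstar_ae; apply: eqL2_mul => //.
by apply/ae_eqL2P; rewrite (_ : [set _ | _] = set0);
  [exact: negligible_set0|apply/seteqP; split=> x // -[]].
Qed.

Lemma mulL2_lin p (a : C) F G : bounded_borel p ->
  mulL2 p (a *: F + G) = a *: mulL2 p F + mulL2 p G.
Proof.
move=> pB; apply/val_inj/funext => x /=; rewrite !mulL2E//.
transitivity (p x * (a * (F x : C) + (G x : C))); first by [].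
by rewrite mulrDr mulrCA.
Qed.

Lemma mult_op_linear p : bounded_borel p -> linear (mult_op p).
Proof.
move=> pB a f g.
by rewrite /mult_op (Rstar_ae U (eqL2_mulr pB (Rop_lin U a f g))) mulL2_lin// linearP.
Qed.

Lemma mult_op_lin (a : C) p q : bounded_borel p -> bounded_borel q ->
  mult_op (a *: p + q) = a *: mult_op p + mult_op q.
Proof.
move=> pB qB; apply/funext => f; rewrite /mult_op.
transitivity (Rstar U (a *: mulL2 p (Rop U f) + mulL2 q (Rop U f))); last first.
  by rewrite linearP.
congr (Rstar U _); apply/val_inj/funext => x /=.
rewrite !mulL2E//; last exact: bounded_borel_lin.
transitivity ((a * p x + q x) * (Rop U f x : C)); first by [].
by rewrite mulrDl -mulrA.
Qed.

(** The composite contains [Rop] after [Rstar], which is the identity only almost everywhere; the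
    outer [Rstar] absorbs the difference. *)
Lemma mult_op_mul p q : bounded_borel p -> bounded_borel q ->
  mult_op (p * q) = mult_op p \o mult_op q.
Proof.
move=> pB qB; apply/funext => f; rewrite /= {1 2}/mult_op.
rewrite (Rstar_ae U (eqL2_mulr pB (Rop_mult_op q f))); congr (Rstar U _).
apply/val_inj/funext => x /=; rewrite !mulL2E//; last exact: bounded_borelM.
by transitivity ((p x * q x) * (Rop U f x : C)); [|rewrite -mulrA].
Qed.

Lemma mult_op1 : mult_op 1 = id.
Proof.
apply/funext => f; rewrite -[RHS](RstarK U); congr (Rstar U _).
apply/val_inj/funext => x /=; rewrite mulL2E; first exact: mul1r.
exact: bounded_borel_cst.
Qed.

Lemma mult_op_adj p : bounded_borel p -> is_adjoint (mult_op p) (mult_op (conjf p)).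
Proof.
move=> pB f g; rewrite (dotA2C U (mult_op (conjf p) g) f).
rewrite (dotA2_mult_op _ _ (bounded_borel_conj pB)).
rewrite dotA2_mult_op// -cintegral_conj; last 2 first.
- exact: measurable_itv.
- have := L2_cintegrable (mulL2 (conjf p) (Rop U g)) (Rop U f).
  rewrite mulL2E; last exact: bounded_borel_conj.
  by under eq_fun do rewrite -mulrA.
by apply: eq_cintegral => x _; apply/esym; exact: conjc_mul_mulconj.
Qed.

End MultiplicationOperator.

(** * Null sets and operator norms *)

Section OperatorNorm.
Context {R : realType}.
Local Notation C := (R[i]).
Local Notation leb := (@lebesgue_measure R).
Local Notation TR := (measurableTypeR R).
Variables (lam : R) (U : spectral_rep lam).
Implicit Types (p q : R -> C) (F G : L2 R) (f g : A2 lam) (N : set R).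

Let mH : measurable (half_line : set TR). Proof. exact: measurable_itv. Qed.

Definition half_line_null N := leb.-negligible (half_line `&` N).

Lemma half_line_nullS N N' : N `<=` N' -> half_line_null N' -> half_line_null N.
Proof. by move=> NN'; apply: negligibleS => x [Hx /NN']. Qed.

Lemma half_line_nullU N N' :
  half_line_null N -> half_line_null N' -> half_line_null (N `|` N').
Proof. by move=> nN nN'; rewrite /half_line_null setIUr; exact: negligibleU. Qed.

Lemma half_line_null_bigcup (F : (set R)^nat) :
  (forall n, half_line_null (F n)) -> half_line_null (\bigcup_n F n).
Proof. by move=> nF; rewrite /half_line_null setI_bigcupr; exact: negligible_bigcup. Qed.

Lemma half_line_null0 : half_line_null set0.
Proof. by rewrite /half_line_null setI0; exact: negligible_set0. Qed.

Lemma measurable_normc_le p (c : R) : bounded_borel p ->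
  measurable ([set x | normc (p x) <= c] : set TR).
Proof.
move=> [mp _]; have := cmeasurable_normc mp => /(_ measurableT `]-oo, c]%classic).
move=> /(_ (measurable_itv _)); by rewrite setTI; congr measurable.
Qed.

(** Replacing p by 0 where it exceeds M leaves the operator unchanged and makes the bound hold
    everywhere, so the integrals compare pointwise. *)
Lemma normA2_mult_op_le p (M : R) f : bounded_borel p -> 0 <= M ->
  half_line_null [set x | M < normc (p x)] ->
  normA2 (mult_op U p f) <= M * normA2 f.
Proof.
move=> pB M0 nM.
have mS := measurable_normc_le M pB.
set S := [set x | _] in mS.
pose q : R -> C := (fun x => (\1_S x : R)%:C) * p.
have qB : bounded_borel q by apply: bounded_borelM => //; exact: bounded_borel_indic.
have qx x : normc (p x) <= M -> q x = p x.
  by move=> px; rewrite /q mulrfctE indicE mem_set// mul1r.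
have qx0 x : M < normc (p x) -> q x = 0.
  move=> px; rewrite /q mulrfctE indicE memNset ?mul0r//.
  by apply/negP; rewrite -ltNge.
have qM x : normc (q x) <= M.
  have [px|px] := leP (normc (p x)) M; first by rewrite qx.
  by rewrite qx0// Normc.normc0.
have -> : mult_op U p = mult_op U q.
  apply: mult_op_ae => //; apply: half_line_nullS nM => x /=.
  by apply: contra_notP => /negP; rewrite -leNgt => /qx.
rewrite -ler_sqr ?nnegrE ?mulr_ge0 ?normA2_ge0// exprMn !(sqr_normA2 U).
rewrite (eqL2_sqmod (Rop_mult_op U q f)) -RintegralZl//; last first.
  exact: integrable_sqmodL2.
apply: le_Rintegral => //.
- exact: integrable_sqmodL2.
- exact: (integrableZl mH (M ^+ 2) (integrable_sqmodL2 (Rop U f))).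
- move=> x _; rewrite mulL2E// sqmodM ler_wpM2r ?sqmod_ge0// sqmod_normc.
  by rewrite ler_sqr ?nnegrE// normc_ge0.
Qed.

(** For the test function F = chi_S exp(- xi), the integrand |p F|^2 - c^2 |F|^2 is nonnegative, and
    the hypothesis makes its integral at most 0. So it vanishes almost everywhere, although it is
    positive on S. *)
Lemma mult_op_norm_null p (c : R) : bounded_borel p -> 0 <= c ->
  (forall f, normA2 (mult_op U p f) <= c * normA2 f) ->
  half_line_null [set x | c < normc (p x)].
Proof.
move=> pB c0 pc.
have mS : measurable ([set x | c < normc (p x)] : set TR).
  have := measurableC (measurable_normc_le c pB); congr measurable.
  by apply/seteqP; split=> x /=; rewrite ltNge; [move/negP|move/negP].
set S := [set x | _] in mS *.
have SB := bounded_borel_indic mS.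
have [w wE] := mkL2 (@isL2_exp_decay R).
pose F := mulL2 (fun x => (\1_S x : R)%:C) w.
have FE x : F x = (\1_S x * expR (- x))%:C.
  by rewrite /F mulL2E// wE /exp_decay -rmorphM.
pose g x := sqmod (p x * F x) - c ^+ 2 * sqmod (F x).
have gE x : g x = (sqmod (p x) - c ^+ 2) * sqmod (F x) by rewrite /g sqmodM mulrBl.
have FS x : ~ S x -> F x = 0.
  by move=> Sx; rewrite FE indicE memNset// mul0r.
have pS x : S x -> 0 < sqmod (p x) - c ^+ 2.
  move=> Sx; rewrite subr_gt0 sqmod_normc ltr_sqr ?nnegrE//.
  exact: normc_ge0.
have g0 x : 0 <= g x.
  rewrite gE; have [Sx|Sx] := pselect (S x).
    by rewrite mulr_ge0 ?sqmod_ge0// ltW// pS.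
  by rewrite FS// /sqmod /= expr0n /= addr0 mulr0.
have ipF := integrable_sqmodL2 (mulL2 p F).
rewrite mulL2E// in ipF.
have icF := integrableZl mH (c ^+ 2) (integrable_sqmodL2 F).
have ig : leb.-integrable half_line (EFin \o g) by exact: (integrableB mH ipF icF).
have Ig : \int[leb]_(x in half_line) g x <= 0.
  rewrite RintegralB// subr_le0 RintegralZl//; last exact: integrable_sqmodL2.
  have : normA2 (mult_op U p (Rstar U F)) ^+ 2 <= (c * normA2 (Rstar U F)) ^+ 2.
    by rewrite ler_sqr ?nnegrE ?mulr_ge0 ?normA2_ge0.
  rewrite exprMn !(sqr_normA2 U).
  rewrite (eqL2_sqmod (RopK U F)) (eqL2_sqmod (Rop_mult_op U p _)).
  by rewrite (eqL2_sqmod (eqL2_mulr pB (RopK U F))) mulL2E.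
apply: negligibleS (ge0_Rintegral_eq0 mH ig (fun x _ => g0 x) Ig) => x [Hx Sx] /=.
split => // /eqP; rewrite gE mulf_eq0 gt_eqF ?pS//= sqmod_eq0 FE indicE mem_set//.
by rewrite mul1r eq_complex /= gt_eqF ?expR_gt0.
Qed.

Lemma mult_op_bounded p : bounded_borel p -> bounded_op (mult_op U p).
Proof.
move=> pB; split; first exact: mult_op_linear.
have [_ [M pM]] := pB; exists M => f; apply: normA2_mult_op_le => //.
  exact: le_trans (normc_ge0 _) (pM 0).
apply: half_line_nullS half_line_null0 => x /=.
by rewrite ltNge pM.
Qed.

(** This is [mult_op_norm_null] with c = 0 for p - q, written in the form that [mult_op_lin]
    accepts. *)
Lemma mult_op_inj p q :
  bounded_borel p -> bounded_borel q -> mult_op U p = mult_op U q ->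
  half_line_null [set x | p x <> q x].
Proof.
move=> pB qB pq.
have dB : bounded_borel (-1 *: q + p) by exact: bounded_borel_lin.
have M0 : mult_op U (-1 *: q + p) = (fun=> 0).
  rewrite mult_op_lin// pq; apply/funext => f.
  by transitivity (-1 *: mult_op U q f + mult_op U q f); rewrite // scaleN1r addNr.
have : half_line_null [set x | 0 < normc ((-1 *: q + p) x)].
  apply: mult_op_norm_null => // f; rewrite M0 mul0r /normA2 (dotA2_sqmod U).
  have -> : \int[leb]_(x in half_line) sqmod (Rop U 0 x) = 0.
    rewrite -(linear0 (Rstar U)) (eqL2_sqmod (RopK U 0)).
    transitivity (\int[leb]_(x in half_line) (0 : R)).
      by apply: eq_Rintegral => x _; rewrite /sqmod /= expr0n /= addr0.
    by rewrite (Rintegral_cst leb mH) mul0r.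
  by rewrite /= sqrtr0.
apply: half_line_nullS => x /= pqx; rewrite lt_neqAle normc_ge0 andbT eq_sym.
apply/eqP => /Normc.eq0_normc h; apply: pqx; apply/eqP; rewrite -subr_eq0.
have {}h : -1 * q x + p x = 0 := h.
by rewrite addrC -mulN1r h.
Qed.

(** Forward, E(S) is applied to the inverse image of exp(- xi), whose product with the indicator of
    S vanishes only off S. *)
Lemma E_nullE N : E_null U N <-> half_line_null N.
Proof.
split=> [[S [mS NS S0]]|[S [mS S0 NS]]].
- apply: half_line_nullS NS _.
  have [w wE] := mkL2 (@isL2_exp_decay R).
  have SB := bounded_borel_indic mS.
  have E : eqL2 (mulL2 (fun x => (\1_S x : R)%:C) w) 0.
    apply: eqL2_trans (eqL2_mulr SB (eqL2_sym (RopK U w))) _.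
    rewrite -[mulL2 _ _]/(indicL2 S (Rop U (Rstar U w))).
    apply: eqL2_trans (eqL2_sym (RopK U _)) _.
    rewrite -/(specE U S (Rstar U w)) S0 -(linear0 (Rstar U)).
    exact: RopK.
  move/ae_eqL2P: E; apply: negligibleS => x [Hx Sx]; split => //.
  rewrite mulL2E// wE indicE mem_set// mul1r => /eqP.
  by rewrite eq_complex /= gt_eqF ?expR_gt0.
(* S covers only the trace of N on the half-line; the complement of the half-line is a Borel set on
   which [E] vanishes. *)
- exists (S `|` ~` half_line); split.
  + by apply: measurableU => //; exact: measurableC.
  + by move=> x Nx; have [Hx|?] := pselect (half_line x); [left; apply: NS|right].
  + move=> f; rewrite /specE -(linear0 (Rstar U)); apply: Rstar_ae.
    apply/ae_eqL2P; exists S; split => // x /= [Hx].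
    rewrite indicL2E; last by apply: measurableU => //; exact: measurableC.
    rewrite indicE; have [//|Sx] := pselect (S x).
    by rewrite memNset ?mul0r// => -[].
Qed.

(** Homogeneity extends the bound from the unit ball to all vectors; a vector of norm 0 cannot be
    normalized, but it is 0 by definiteness. *)
Lemma opnorm_mult_op p (c : R) : bounded_borel p -> 0 <= c ->
  (forall f, normA2 f <= 1 -> normA2 (mult_op U p f) <= c) ->
  half_line_null [set x | c < normc (p x)].
Proof.
move=> pB c0 pc; apply: mult_op_norm_null => // f.
have linM := mult_op_linear U pB.
have MZ (a : C) (h : A2 lam) : mult_op U p (a *: h) = a *: mult_op U p h.
  have M0 : mult_op U p 0 = 0.
    by have := linM (-1) 0 0; rewrite scaleN1r oppr0 addr0 scaleN1r addNr.
  by rewrite -[a *: h]addr0 linM M0 addr0.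
have nZ (r : R) (h : A2 lam) : 0 <= r -> normA2 (r%:C *: h) = r * normA2 h.
  move=> r0; apply/eqP; rewrite -(@eqrXn2 _ 2) ?mulr_ge0 ?normA2_ge0// exprMn.
  have -> : r%:C *: h = Rstar U (r%:C *: Rop U h) by rewrite linearZ/= RstarK.
  rewrite !(sqr_normA2 U) (eqL2_sqmod (RopK U _)) -RintegralZl//; last first.
    exact: integrable_sqmodL2.
  apply/eqP; apply: eq_Rintegral => x _.
  transitivity (sqmod (r%:C * (Rop U h x : C))); first by [].
  by rewrite sqmodM /sqmod /= expr0n /= addr0.
have [f0|f0] := eqVneq (normA2 f) 0.
  rewrite f0 mulr0.
  have -> : f = 0.
    apply: (dotA2_eq0 U); rewrite (dotA2_sqmod U) -(sqr_normA2 U) f0.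
    by rewrite expr0n.
  by have := MZ 0 0; rewrite !scale0r => ->; have := nZ 0 0 (lexx _);
    rewrite scale0r mul0r => ->.
have fp : 0 < normA2 f by rewrite lt_neqAle eq_sym f0 normA2_ge0.
have := pc ((normA2 f)^-1%:C *: f).
rewrite MZ !nZ ?invr_ge0 ?normA2_ge0// mulVf// => /(_ (lexx _)).
by rewrite ler_pdivrMl// mulrC.
Qed.

End OperatorNorm.

(** * Completed measures and measures with a density *)

Section CaratheodoryHull.
Local Open Scope ereal_scope.
Local Open Scope measure_scope.
Context d (T : semiRingOfSetsType d) (R : realType).
Variable mu : {measure set T -> \bar R}.
Local Notation Borel := (d.-measurable).-sigma.-measurable.

(** Choose countable covers by elements of the semiring whose total mass exceeds the outer measure
    by less than 1/(n+1), and intersect their unions over n. If the outer measure is infinite, the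
    whole space serves. *)
Lemma mu_ext_hull (E : set T) :
  exists F, [/\ Borel F, E `<=` F & mu^* F = mu^* E].
Proof.
have [Eoo|Efin] := eqVneq (mu^* E) +oo.
  exists setT; split => //.
  by apply/eqP; rewrite Eoo -leye_eq -Eoo; exact: le_mu_ext.
have {}Efin : mu^* E \is a fin_num by rewrite ge0_fin_numE ?ltey// mu_ext_ge0.
have covE n : exists A, measurable_cover E A /\
    \sum_(0 <= k <oo) mu (A k) < mu^* E + n.+1%:R^-1%:E.
  have n0 : (0 < n.+1%:R^-1 :> R)%R by rewrite invr_gt0.
  have := lb_ereal_inf_adherent n0 Efin.
  by move=> [_ [A cA <-] ?]; exists A.
have {covE}[A /all_and2[cA AE]] := choice covE.
exists (\bigcap_n \bigcup_m A n m); split.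
- apply: (@bigcapT_measurable _ (g_sigma_algebraType d.-measurable)) => n.
  apply: (@bigcupT_measurable _ (g_sigma_algebraType d.-measurable)) => m.
  by apply: sub_sigma_algebra; exact: (cA n).1.
- by apply: sub_bigcap => n _; exact: (cA n).2.
apply/eqP; rewrite eq_le; apply/andP; split; last first.
  by apply: le_mu_ext; apply: sub_bigcap => n _; exact: (cA n).2.
apply/lee_addgt0Pr => /= _/posnumP[e]; near \oo => n.
apply: (@le_trans _ _ (mu^* (\bigcup_m A n m))).
  by apply: le_mu_ext; exact: bigcap_inf.
apply: (@le_trans _ _ (\sum_(0 <= k <oo) mu (A n k))).
  apply: (le_trans (outer_measure_sigma_subadditive mu^* (A n))).
  apply: lee_nneseries => // k _.
  by rewrite -((measurable_mu_extE mu) (A n k))//; exact: (cA n).1.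
rewrite (le_trans (ltW (AE n)))// leeD2l// lee_fin ltW//.
by near: n; exact: near_infty_natSinv_lt.
Unshelve. all: by end_near. Qed.

(* F is a Borel hull of E, and G a Borel hull of F minus E. *)
Lemma caratheodory_borel (E : set T) : mu^* setT < +oo ->
  mu^*.-cara.-measurable E ->
  exists F G, [/\ Borel F, Borel G, E `<=` F, F `\` E `<=` G & mu^* G = 0].
Proof.
move=> Too mE; have [F [mF EF FE]] := mu_ext_hull E.
have [G [mG FEG GFE]] := mu_ext_hull (F `\` E).
exists F, G; split => //; rewrite GFE.
have Foo : mu^* F < +oo by apply: le_lt_trans Too; exact: le_mu_ext.
have mF' : mu^*.-cara.-measurable F by exact: sub_caratheodory.
(* On Caratheodory sets the outer measure is a measure, so the equal finite values at F and E can be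
   subtracted. *)
transitivity (@completed_measure_extension _ _ _ mu (F `\` E)); first by [].
rewrite measureD// setIidr//.
transitivity (mu^* F - mu^* E); first by [].
rewrite FE subee//.
by rewrite ge0_fin_numE ?mu_ext_ge0// -FE.
Qed.

(** Only the superlevel sets at rational heights are replaced by Borel hulls, so the exceptional
    null sets have a null union. *)
Lemma caratheodory_measurable_fun (h : T -> R) : mu^* setT < +oo ->
  measurable_fun (setT : set (caratheodory_type mu^*)) h ->
  exists G, [/\ Borel G, mu^* G = 0 &
    measurable_fun (~` G : set (g_sigma_algebraType d.-measurable)) h].
Proof.
(* An enumeration of the rationals; codes of no rational give 0, which only repeats a value. *)
move=> Too mh; pose e n : R := ratr (odflt 0%R (unpickle n : option rat)).
have FGn n : exists FG : set T * set T, [/\ Borel FG.1, Borel FG.2,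
    [set x | (e n < h x)%R] `<=` FG.1,
    FG.1 `\` [set x | (e n < h x)%R] `<=` FG.2 & mu^* FG.2 = 0].
  have mE : mu^*.-cara.-measurable [set x | (e n < h x)%R].
    have := mh measurableT `]e n, +oo[%classic (measurable_itv _).
    rewrite setTI; congr measurable.
    by apply/seteqP; split=> x; rewrite /= in_itv/= andbT.
  by have [F [G [? ? ? ? ?]]] := caratheodory_borel Too mE; exists (F, G).
have {FGn}[FG FGP] := choice FGn.
have mF n : Borel (FG n).1 by have [] := FGP n.
have mG n : Borel (FG n).2 by have [] := FGP n.
have mUG : Borel (\bigcup_n (FG n).2).
  exact: (@bigcupT_measurable _ (g_sigma_algebraType d.-measurable)).
exists (\bigcup_n (FG n).2); split => //.
  apply/eqP; rewrite eq_le; apply/andP; split; last exact: mu_ext_ge0.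
  apply: (le_trans (outer_measure_sigma_subadditive mu^* (fun n => (FG n).2))).
  by rewrite eseries0// => n _ _; have [] := FGP n.
apply: (measurability _ (RGenOInfty.measurableE R)) => _ [_ [y ->] <-].
(* Off the null set each hull agrees with its superlevel set, and h > y holds exactly when some
   rational lies strictly between y and h. *)
pose A n := if (y < e n)%R then (FG n).1 else set0.
rewrite (_ : _ `&` _ = ~` (\bigcup_n (FG n).2) `&` \bigcup_n A n).
  apply: (@measurableI _ (g_sigma_algebraType d.-measurable)).
    exact: (@measurableC _ (g_sigma_algebraType d.-measurable)).
  apply: (@bigcupT_measurable _ (g_sigma_algebraType d.-measurable)) => n.
  by rewrite /A; case: ifP.
apply/seteqP; split=> x [nG] /=.
- rewrite in_itv/= andbT => yh; split => //.
  have [q] := rat_in_itvoo yh; rewrite in_itv/= => /andP[yq qh].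
  have eq : e (pickle q) = ratr q by rewrite /e pickleK.
  by exists (pickle q) => //; rewrite /A eq yq; have [_ _ + _ _] := FGP (pickle q);
    apply; rewrite /= eq.
- move=> [n _]; rewrite /A; case: ifP => // yn Fx.
  split => //; rewrite in_itv/= andbT; apply: (lt_trans yn).
  have [//|hx] := pselect (e n < h x)%R; exfalso; apply: nG; exists n => //.
  by have [_ _ _ + _] := FGP n; apply.
Qed.

End CaratheodoryHull.

Section Density.
Local Open Scope ereal_scope.
Context d (T : measurableType d) (R : realType).
Variables (mu : {measure set T -> \bar R}) (w : T -> R).
Hypotheses (mw : measurable_fun setT w) (w0 : forall x, (0 <= w x)%R).

Import HBNNSimple.

Definition density_measure (A : set T) := \int[mu]_(x in A) (w x)%:E.

Let density0 : density_measure set0 = 0.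
Proof. exact: integral_set0. Qed.

Let density_ge0 A : 0 <= density_measure A.
Proof. by apply: integral_ge0 => x _; rewrite lee_fin. Qed.

Let density_sigma_additive : semi_sigma_additive density_measure.
Proof.
move=> /= F mF tF mUF; rewrite /density_measure; apply: cvg_toP.
  apply: ereal_nondecreasing_is_cvgn => m n mn.
  by apply: lee_sum_nneg_natr => // k _ _; exact: density_ge0.
rewrite ge0_integral_bigcup//=; first exact/measurable_funTS/measurable_EFinP.
by move=> x _; rewrite lee_fin.
Qed.

HB.instance Definition _ := isMeasure.Build _ _ _
  density_measure density0 density_ge0 density_sigma_additive.

Definition density : {measure set T -> \bar R} := density_measure.

Variable nu : {measure set T -> \bar R}.
Hypothesis nuE : forall A, measurable A -> nu A = density_measure A.

(** Monotone convergence reduces to simple functions and finite sums to indicators, where [nuE]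
    applies. *)
Lemma ge0_integral_density (f : T -> \bar R) :
  measurable_fun setT f -> (forall x, 0 <= f x) ->
  \int[nu]_x f x = \int[mu]_x (f x * (w x)%:E).
Proof.
move=> mf f0; pose h := nnsfun_approx measurableT mf.
have nd x : {homo (fun n => h n x) : a b / (a <= b)%N >-> (a <= b)%R}.
  by move=> a b ab; exact/lefP/nd_nnsfun_approx.
have mwE : measurable_fun setT (EFin \o w) by exact/measurable_EFinP.
have -> : \int[nu]_x f x = limn (fun n => \int[nu]_x (h n x)%:E).
  rewrite -monotone_convergence//=.
  - apply: eq_integral => x _; apply/esym/cvg_lim => //.
    by apply: cvg_nnsfun_approx => // ? _.
  - by move=> n; exact/measurable_EFinP.
  - by move=> n x _; rewrite lee_fin.
  - by move=> x _ a b ab; rewrite lee_fin nd.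
have -> : \int[mu]_x (f x * (w x)%:E) =
    limn (fun n => \int[mu]_x ((h n x)%:E * (w x)%:E)).
  rewrite -monotone_convergence//=.
  - apply: eq_integral => x _; apply/esym/cvg_lim => //.
    apply: cvgeZr => //; by apply: cvg_nnsfun_approx => // ? _.
  - by move=> n; apply: emeasurable_funM => //; exact/measurable_EFinP.
  - by move=> n x _; rewrite mule_ge0// lee_fin.
  - by move=> x _ a b ab; rewrite lee_wpmul2r// lee_fin ?nd.
congr (limn _); apply/funext => n.
have indm r : measurable (h n @^-1` [set r]) by exact: measurable_funPTI.
have mind r : measurable_fun setT (fun x => (r * \1_(h n @^-1` [set r]) x)%:E).
  by apply/measurable_EFinP; apply: measurable_funM => //; exact: measurable_indic.
transitivity (\sum_(r \in range (h n))
    \int[nu]_x (r * \1_(h n @^-1` [set r]) x)%:E).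
  rewrite -ge0_integral_fsum//; last by move=> r x _; exact: nnfun_muleindic_ge0.
  by apply: eq_integral => x _; rewrite fimfunE -fsumEFin.
transitivity (\sum_(r \in range (h n))
    \int[mu]_x ((r * \1_(h n @^-1` [set r]) x)%:E * (w x)%:E)); last first.
  rewrite -ge0_integral_fsum//.
  - apply: eq_integral => x _.
    rewrite -ge0_mule_fsuml => [|r]; last exact: nnfun_muleindic_ge0.
    by rewrite fsumEFin// -fimfunE.
  - by move=> r; exact: emeasurable_funM.
  - move=> r x _; apply: mule_ge0; last by rewrite lee_fin.
    exact: nnfun_muleindic_ge0.
apply: eq_fsbigr => r /set_mem[t _ <-].
under eq_integral do rewrite EFinM.
under [RHS]eq_integral do rewrite EFinM -muleA.
rewrite !ge0_integralZl ?lee_fin//.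
- congr (_ * _); rewrite integral_indic// setIT nuE// /density_measure.
  rewrite [LHS]integral_mkcond; apply: eq_integral => x _.
  by rewrite epatch_indic/= muleC.
- apply: emeasurable_funM => //; apply/measurable_EFinP; exact: measurable_indic.
- by move=> x _; rewrite mule_ge0 ?lee_fin.
- by apply/measurable_EFinP; exact: measurable_indic.
Qed.

(** Multiplication by the nonnegative w commutes with positive and negative parts, which is
    [maxM]. *)
Lemma integral_density (f : T -> R) : measurable_fun setT f ->
  \int[nu]_x (f x)%:E = \int[mu]_x (f x * w x)%:E.
Proof.
move=> mf; have mfE : measurable_fun setT (EFin \o f) by exact/measurable_EFinP.
have maxM (a b : R) : (0 <= b)%R -> maxe a%:E 0 * b%:E = maxe (a * b)%:E 0.
  move=> b0; have [a0|/ltW a0] := leP 0%R a.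
    by rewrite !max_l ?lee_fin ?mulr_ge0// EFinM.
  by rewrite !max_r ?mul0e ?lee_fin ?mulr_le0_ge0.
rewrite integralE [RHS]integralE; congr (_ - _).
- rewrite ge0_integral_density//; last exact: measurable_funepos.
  by apply: eq_integral => x _; rewrite !funeposE maxM.
- rewrite ge0_integral_density//; last exact: measurable_funeneg.
  by apply: eq_integral => x _; rewrite !funenegE -!EFinN maxM// mulNr.
Qed.

End Density.

(** * The Stieltjes measures of rho *)

Section SpectralDensity.
Context {R : realType}.
Local Notation C := (R[i]).
Local Notation leb := (@lebesgue_measure R).
Local Notation TR := (measurableTypeR R).
Variables (lam : R) (U : spectral_rep lam).
Implicit Types (phi psi p q : R -> C) (f g h : A2 lam) (N : set R).

Let mH : measurable (half_line : set TR). Proof. exact: measurable_itv. Qed.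

Definition spectral_density f : TR -> R :=
  (fun x => sqmod (Rop U f x)) \_ half_line.

Lemma spectral_density_ge0 f x : 0 <= spectral_density f x.
Proof. by rewrite /spectral_density patchE; case: ifP => // _; exact: sqmod_ge0. Qed.

Lemma integrable_spectral_density f :
  leb.-integrable setT (EFin \o spectral_density f).
Proof.
rewrite /spectral_density -restrict_EFin.
exact: ((integrable_mkcond _ mH).1 (integrable_sqmodL2 (Rop U f))).
Qed.

Lemma measurable_spectral_density f :
  measurable_fun (setT : set TR) (spectral_density f).
Proof.
by apply/measurable_EFinP; exact: measurable_int (integrable_spectral_density f).
Qed.

(** [rho] is defined with the open interval. The endpoint has Lebesgue measure 0, and the closed
    form fits the intervals ]a, b] that generate Stieltjes measures. *)
Lemma rho_itv f (b : R) :
  rho U f b = \int[leb]_(x in `]-oo, b]) spectral_density f x.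
Proof.
have i S : measurable (S : set TR) ->
    leb.-integrable S (EFin \o spectral_density f).
  by move=> mS; apply: integrableS (integrable_spectral_density f).
rewrite -Rintegral_itv_bndo_bndc; last by apply: i; exact: measurable_itv.
rewrite rhoE Rintegral_mkcond [RHS]Rintegral_mkcond.
apply: eq_Rintegral => x _; rewrite /spectral_density !patchE indicE.
by case: (x \in `]-oo, b[%classic); case: (x \in half_line); rewrite ?mul1r ?mul0r.
Qed.

Local Notation dens f := (density_measure leb (spectral_density f)).

(** By uniqueness of the extension it is enough to compare on the intervals ]a, b], where both sides
    are the increment of [rho U f]. *)
Lemma lebesgue_stieltjes_rho f (A : set TR) : measurable A ->
  lebesgue_stieltjes_measure (rho U f) A = dens f A.
Proof.
move=> mA.
rewrite -[RHS]/(density leb (measurable_spectral_density f)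
  (spectral_density_ge0 f) A).
apply: lebesgue_stieltjes_measure_unique mA => X [[a b]] _ <-.
rewrite /lebesgue_stieltjes_measure /measure_extension measurable_mu_extE/=; last first.
  exact: is_ocitv.
have [ab|ba] := leP a b; last first.
  rewrite (_ : `]a, b]%classic = set0) ?wlength0; last first.
    by rewrite set_itv_ge// bnd_simp -leNgt ltW.
  by apply/esym; exact: integral_set0.
rewrite wlength_itv_bnd// !rho_itv Rintegral_itvB ?bnd_simp//; last first.
  apply: integrableS (integrable_spectral_density f) => //; exact: measurable_itv.
rewrite /density /= /density_measure fineK//.
apply: integrable_fin_num; first exact: measurable_itv.
by apply: integrableS (integrable_spectral_density f) => //; exact: measurable_itv.
Qed.

Lemma spectral_density_fin f : (dens f setT < +oo)%E.
Proof. exact: integrable_lty (integrable_spectral_density f). Qed.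

(** Absolute continuity, valid for every f: the density vanishes off the half-line, so the cover may
    absorb the complement. *)
Lemma spectral_density_null f N : half_line_null N ->
  exists S : set TR, [/\ measurable S, N `<=` S & dens f S = 0%E].
Proof.
move=> [A [mA A0 NA]]; exists (A `|` ~` half_line); split.
- by apply: measurableU => //; exact: measurableC.
- by move=> x Nx; have [Hx|?] := pselect (half_line x); [left; apply: NA|right].
have mU : measurable (A `|` ~` half_line : set TR).
  by apply: measurableU => //; exact: measurableC.
transitivity (\int[leb]_(x in A `|` ~` half_line)
    ((EFin \o (fun x => sqmod (Rop U f x))) \_ half_line) x)%E.
  by apply: eq_integral => x _; rewrite restrict_EFin.
rewrite -integral_mkcondr setIUl setICl setU0 null_set_integral//.
- exact: measurableI.
- apply: measurable_funS (measurable_int _ (integrable_sqmodL2 (Rop U f))) => //.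
- apply/eqP; rewrite -measure_le0 -A0; apply: le_measure; rewrite ?inE//.
  exact: measurableI.
Qed.

(** The converse direction, for the one vector whose density is almost everywhere positive on the
    half-line. *)
Lemma null_spectral_density_exp_decay (w : L2 R) (G : set TR) :
  w = @exp_decay R :> (R -> C) -> measurable G ->
  dens (Rstar U w) G = 0%E -> half_line_null G.
Proof.
move=> wE mG G0; set f := Rstar U w in G0 *.
have N : leb.-negligible [set x | G x /\ spectral_density f x <> 0].
  apply: (@ge0_Rintegral_eq0 _ _ _ leb) => //.
  - by apply: integrableS (integrable_spectral_density f).
  - by move=> x _; exact: spectral_density_ge0.
  - by rewrite /Rintegral -[X in fine X]/(dens f G) G0.
have /ae_eqL2P Nw := RopK U w.
apply: negligibleS (negligibleU N Nw) => x [Hx Gx] /=.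
have [E|] := pselect (Rop U f x = w x); [left|by right].
split => //; rewrite /spectral_density patchE mem_set// E wE => /eqP.
by rewrite sqmod_eq0 eq_complex /= gt_eqF ?expR_gt0.
Qed.

End SpectralDensity.

(** * Bounded Borel representatives of essentially bounded functions *)

Section BorelRepresentatives.
Context {R : realType}.
Local Notation C := (R[i]).
Local Notation leb := (@lebesgue_measure R).
Local Notation TR := (measurableTypeR R).
Variables (lam : R) (U : spectral_rep lam).
Implicit Types (phi psi p q : R -> C) (f g h : A2 lam) (N : set R).

Definition borel_rep phi p := bounded_borel p /\ half_line_null [set x | phi x <> p x].

Lemma borel_rep_self p : bounded_borel p -> borel_rep p p.
Proof.
by move=> pB; split=> //; apply: half_line_nullS half_line_null0 => x /=.
Qed.

Lemma borel_rep_lin (a : C) phi psi p q : borel_rep phi p -> borel_rep psi q ->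
  borel_rep (a *: phi + psi) (a *: p + q).
Proof.
move=> [pB phip] [qB psiq]; split; first exact: bounded_borel_lin.
apply: half_line_nullS (half_line_nullU phip psiq) => x /=.
apply: contra_notP => /not_orP[/contrapT h1 /contrapT h2].
by transitivity (a * phi x + psi x); rewrite // h1 h2.
Qed.

Lemma borel_repM phi psi p q : borel_rep phi p -> borel_rep psi q ->
  borel_rep (phi * psi) (p * q).
Proof.
move=> [pB phip] [qB psiq]; split; first exact: bounded_borelM.
apply: half_line_nullS (half_line_nullU phip psiq) => x /=.
apply: contra_notP => /not_orP[/contrapT h1 /contrapT h2].
by rewrite !mulrfctE h1 h2.
Qed.

Lemma borel_rep_conj phi p : borel_rep phi p -> borel_rep (conjf phi) (conjf p).
Proof.
move=> [pB phip]; split; first exact: bounded_borel_conj.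
by apply: half_line_nullS phip => x /=; apply: contra_not; rewrite /conjf => ->.
Qed.

(** The Stieltjes measure is the outer measure by conversion; this lets null sets of the completion
    be recognized by the density. *)
Lemma mu_ext_rho f (A : set TR) : measurable A ->
  (wlength (rho U f))^*%mu A = density_measure leb (spectral_density U f) A.
Proof. exact: lebesgue_stieltjes_rho. Qed.

Lemma ae_rho f phi psi : half_line_null [set x | phi x <> psi x] ->
  {ae completed_lebesgue_stieltjes_measure (rho U f), forall x, phi x = psi x}.
Proof.
move=> /(spectral_density_null U f)[S [mS NS S0]]; exists S; split.
- exact: sub_caratheodory.
- by rewrite -S0 -mu_ext_rho.
- by move=> x /= ne; apply: NS.
Qed.

Lemma caratheodory_of_borel f (h : R -> R) :
  measurable_fun (setT : set TR) h -> measurable_fun (setT : set (rho_type U f)) h.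
Proof.
move=> mh _ Y mY; apply: sub_caratheodory; have := mh measurableT Y mY.
by rewrite !setTI.
Qed.

Lemma ae_rho_measurable f (h k : R -> R) : measurable_fun (setT : set TR) k ->
  {ae completed_lebesgue_stieltjes_measure (rho U f), forall x, h x = k x} ->
  measurable_fun (setT : set (rho_type U f)) h.
Proof.
move=> mk hk; apply/measurable_EFinP.
apply: (@ae_measurable_fun _ (rho_type U f) _
  (completed_lebesgue_stieltjes_measure (rho U f)) _ _ (EFin \o k)).
- exact: measure_is_complete_caratheodory.
- by apply: negligibleS hk => x /=; apply: contra_not => -> _.
- by apply/measurable_EFinP; exact: caratheodory_of_borel.
Qed.

Lemma borel_rep_measurable f phi p : borel_rep phi p ->
  cmeasurable (setT : set (rho_type U f)) phi.
Proof.
move=> [[[mr mi] _] /(ae_rho f) ae]; split.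
- apply: ae_rho_measurable mr _.
  by apply: negligibleS ae => x /=; apply: contra_not => ->.
- apply: ae_rho_measurable mi _.
  by apply: negligibleS ae => x /=; apply: contra_not => ->.
Qed.

Lemma borel_rep_Linfty phi p : borel_rep phi p -> Linfty U phi.
Proof.
move=> rp; split; first by move=> f; exact: borel_rep_measurable rp.
have [[_ [M pM]] phip] := rp; exists M; split.
  exact: le_trans (normc_ge0 _) (pM 0).
apply/E_nullE; apply: half_line_nullS phip => x /= + E.
by rewrite E ltNge pM.
Qed.

Lemma Linfty_borel_rep phi : Linfty U phi -> exists p, borel_rep phi p.
Proof.
move=> [mphi [M [M0 /E_nullE nM]]].
have [w wE] := mkL2 (@isL2_exp_decay R).
pose f := Rstar U w; have [mr mi] := mphi f.
have Too : ((wlength (rho U f))^*%mu setT < +oo)%E.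
  by rewrite mu_ext_rho//; exact: spectral_density_fin.
have [G [mG G0 Gr]] := caratheodory_measurable_fun Too mr.
have [G' [mG' G'0 Gi]] := caratheodory_measurable_fun Too mi.
have nG : half_line_null G.
  by apply: (null_spectral_density_exp_decay (U := U) wE) => //; rewrite -mu_ext_rho.
have nG' : half_line_null G'.
  by apply: (null_spectral_density_exp_decay (U := U) wE) => //; rewrite -mu_ext_rho.
(* The set where |phi| exceeds M need not be Borel, hence this Borel cover. *)
have [S [mS NS S0]] := spectral_density_null U f nM.
have nS : half_line_null S by exact: (null_spectral_density_exp_decay (U := U) wE).
pose Z : set TR := G `|` G' `|` S.
have mZ : measurable Z by apply: measurableU => //; exact: measurableU.
(* The value 0 on the Borel null set Z makes Borel measurability and the bound M, known off Z, hold
   everywhere. *)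
exists (fun x => (\1_(~` Z) x : R)%:C * phi x); split.
  split.
    have mI (k : R -> R) : measurable_fun (~` Z) k ->
        measurable_fun setT (fun x => \1_(~` Z) x * k x).
      move=> mk; rewrite (_ : (fun x => _) = k \_ (~` Z)).
        by apply/(measurable_restrictT _ _).1 => //; exact: measurableC.
      apply/funext => x; rewrite patchE indicE.
      by case: (x \in _); rewrite ?mul1r ?mul0r.
    split.
      rewrite (_ : (fun x => _) = fun x => \1_(~` Z) x * Re (phi x)).
        apply: mI; apply: measurable_funS Gr; first exact: measurableC.
        by apply: subsetC => x ?; left; left.
      by apply/funext => x; case: (phi x) => a b /=; rewrite mul0r subr0.
    rewrite (_ : (fun x => _) = fun x => \1_(~` Z) x * Im (phi x)).
      apply: mI; apply: measurable_funS Gi; first exact: measurableC.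
      by apply: subsetC => x ?; left; right.
    by apply/funext => x; case: (phi x) => a b /=; rewrite mul0r addr0.
  exists M => x; rewrite indicE; have [Zx|Zx] := pselect (Z x).
    by rewrite memNset ?mul0r ?Normc.normc0// => /(_ Zx).
  rewrite mem_set// mul1r leNgt; apply/negP => Mx; apply: Zx; right.
  exact: NS.
apply: half_line_nullS (half_line_nullU (half_line_nullU nG nG') nS) => x /=.
apply: contra_notP => Zx; rewrite indicE mem_set ?mul1r// => -[[]|].
all: by move=> ?; apply: Zx; tauto.
Qed.

Lemma int_rhoE f phi p : borel_rep phi p ->
  int_rho U phi f = dotA2 (mult_op U p f) f.
Proof.
move=> rp; have [pB phip] := rp; have [[mr mi] [M pM]] := pB.
rewrite dotA2_mult_op//.
transitivity (cintegral (completed_lebesgue_stieltjes_measure (rho U f)) setT p).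
  apply: (ae_eq_cintegral measurableT (borel_rep_measurable f rp)
    (borel_rep_measurable f (borel_rep_self pB))).
  by apply: negligibleS (ae_rho f phip) => x /=; apply: contra_not => E _.
have key (h : R -> R) : measurable_fun (setT : set TR) h ->
    (forall x, `|h x| <= M) ->
    \int[completed_lebesgue_stieltjes_measure (rho U f)]_x h x =
    \int[leb]_(x in half_line) (h x * sqmod (Rop U f x)).
  move=> mh hM; congr fine.
  transitivity (\int[lebesgue_stieltjes_measure (rho U f)]_x (h x)%:E)%E.
    (* The identity from the completed sigma-algebra to the Borel one is measurable and pushes the
       completed measure forward to the Stieltjes measure. The bound M and the finite total mass
       supply the integrability required to transport the integral. *)
    have mid : measurable_fun (setT : set (rho_type U f))
        (id : rho_type U f -> TR).
      by move=> _ Y mY; rewrite setTI; exact: sub_caratheodory.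
    rewrite (eq_measure_integral (pushforward
      (completed_lebesgue_stieltjes_measure (rho U f)) (id : rho_type U f -> TR))) //.
    rewrite (integral_pushforward mid) //.
    - exact/measurable_EFinP.
    - apply: (measurable_bounded_integrable measurableT).
      + by have := spectral_density_fin U f; rewrite -mu_ext_rho.
      + exact: caratheodory_of_borel.
      + exists M; split; first exact: num_real.
        by move=> y My x _; exact: le_trans (hM x) (ltW My).
  rewrite (integral_density (measurable_spectral_density U f)
    (spectral_density_ge0 U f) (lebesgue_stieltjes_rho U f))//.
  rewrite [RHS]integral_mkcond; apply: eq_integral => x _.
  rewrite /spectral_density !patchE; case: ifP => //; by rewrite mulr0.
congr (_ +i* _).
- rewrite key//; last by move=> x; exact: le_trans (normr_Re _) (pM x).
  apply: eq_Rintegral => x _; rewrite mul_conj_sqmod.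
  by case: (p x) => a b /=; rewrite mulr0 subr0.
- rewrite key//; last by move=> x; exact: le_trans (normr_Im _) (pM x).
  apply: eq_Rintegral => x _; rewrite mul_conj_sqmod.
  by case: (p x) => a b /=; rewrite mulr0 add0r.
Qed.

End BorelRepresentatives.

(** * The functional calculus *)

Section FunctionalCalculusE.
Context {R : realType}.
Local Notation C := (R[i]).
Local Notation leb := (@lebesgue_measure R).
Local Notation TR := (measurableTypeR R).
Variables (lam : R) (U : spectral_rep lam).
Implicit Types (phi psi p q : R -> C) (f g h : A2 lam) (N : set R).

Lemma dotA2_linr (a : C) f g h :
  dotA2 h (a *: f + g) = conjc a * dotA2 h f + dotA2 h g.
Proof.
rewrite (dotA2C U (a *: f + g) h) (dotA2C U f h) (dotA2C U g h) (dotA2_lin U).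
by rewrite rmorphD rmorphM.
Qed.

(** Polarization: i^k and i^(2k) sum to 0 over k < 4, which removes the terms in (f, f), (g, g) and
    (g, f) and leaves four times the term in (f, g). *)
Lemma int_E_mult_op phi p f g : borel_rep phi p ->
  int_E U phi f g = dotA2 (mult_op U p f) g.
Proof.
move=> rp; have [pB _] := rp.
rewrite /int_E; under eq_bigr do rewrite (int_rhoE U _ rp).
pose B f g := dotA2 (mult_op U p f) g.
have Q (a : C) : dotA2 (mult_op U p (f + a *: g)) (f + a *: g) =
    B f f + conjc a * B f g + a * B g f + a * conjc a * B g g.
  rewrite [f + _]addrC (mult_op_linear U pB) (dotA2_lin U) !dotA2_linr /B.
  move: (dotA2 (mult_op U p f) f) (dotA2 (mult_op U p g) f)
    (dotA2 (mult_op U p f) g) (dotA2 (mult_op U p g) g) => Bff Bgf Bfg Bgg.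
  by ring.
set I : C := Num.imaginary.
have II : I * I = -1 by rewrite -expr2 sqrCi.
have cI k : conjc (I ^+ k) = (- I) ^+ k.
  by rewrite -conjCi; exact: rmorphXn.
rewrite -/(B f g) !big_ord_recl big_ord0 /= /bump /= !Q !cI.
have I3 : I ^+ 3 = - I by rewrite exprS expr2 II mulrN1.
rewrite !expr0 !expr1 !sqrrN (exprNn I 3) I3 expr2 II.
set Bff := B f f; set Bfg := B f g; set Bgf := B g f; set Bgg := B g g.
(* [ring] does not know that I * I = -1, so the square stays symbolic until the next rewriting. *)
transitivity (4%:R^-1 *
  ((2 - 2 * (I * I)) * Bfg + (2 + 2 * (I * I)) * Bgf) : C).
  by congr (_ * _); ring.
by rewrite II; field.
Qed.

(** The multiplication operator shows that [xget] does not fall back on its default, and an operator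
    is determined by its sesquilinear form. *)
Lemma funcK_mult_op phi p : borel_rep phi p -> funcK U phi = mult_op U p.
Proof.
move=> rp; have [pB _] := rp.
have : exists T : A2 lam -> A2 lam,
    bounded_op T /\ forall f g, dotA2 (T f) g = int_E U phi f g.
  exists (mult_op U p); split=> [|f g]; first exact: mult_op_bounded.
  by rewrite (int_E_mult_op _ _ rp).
move/(xgetPex (fun=> 0)) => -[_ TE]; apply/funext => f; apply: (dotA2_inj U) => g.
by rewrite TE (int_E_mult_op _ _ rp).
Qed.

Lemma E_norm_ge0 phi : 0 <= E_norm U phi.
Proof.
(* Without an essential bound, [inf] takes its conventional value 0 on the empty set. *)
rewrite /E_norm; have [->|/set0P ne] := eqVneq (E_bound U phi) set0.
  by rewrite inf0.
by apply: lb_le_inf => // x [].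
Qed.

Lemma E_norm_le phi (M : R) : 0 <= M ->
  half_line_null [set x | M < normc (phi x)] -> E_norm U phi <= M.
Proof.
move=> M0 nM; apply: ge_inf; first by exists 0 => x [].
by split=> //; exact/E_nullE.
Qed.

(** The infimum is attained: the set is the countable union of those where |phi| exceeds the norm by
    more than 1/(n+1). *)
Lemma E_norm_null phi : Linfty U phi ->
  half_line_null [set x | E_norm U phi < normc (phi x)].
Proof.
move=> [_ ne].
have hi : has_inf (E_bound U phi) by split=> //; exists 0 => x [].
have nn n : half_line_null
    [set x | E_norm U phi + n.+1%:R^-1 < normc (phi x)].
  have [|M [M0 /E_nullE nM] Mlt] := @inf_adherent _ _ n.+1%:R^-1 _ hi.
    by rewrite invr_gt0.
  by apply: half_line_nullS nM => x /=; apply: lt_trans.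
apply: half_line_nullS (half_line_null_bigcup nn) => x /= /ltr_add_invr[n lt].
by exists n.
Qed.

Lemma normA2_0 : normA2 (0 : A2 lam) = 0.
Proof.
rewrite /normA2; have := dotA2_lin U (-1) 0 0 0.
by rewrite scaler0 addr0 mulN1r addNr => ->; rewrite sqrtr0.
Qed.

(** The essential supremum is itself an essential bound and so bounds the operator; conversely
    [opnorm_mult_op], with c the operator norm, makes c an essential bound. *)
Lemma opnorm_mult_opE phi p : Linfty U phi -> borel_rep phi p ->
  opnorm (mult_op U p) = E_norm U phi.
Proof.
move=> Lphi [pB phip].
have tr (c : R) : half_line_null [set x | c < normc (p x)] <->
    half_line_null [set x | c < normc (phi x)].
  split=> nc; apply: half_line_nullS (half_line_nullU phip nc) => x /= cx;
    have [E|] := pselect (phi x = p x); by [right; rewrite -?E// E|left].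
have Mle f : normA2 f <= 1 -> normA2 (mult_op U p f) <= E_norm U phi.
  move=> f1; apply: (@le_trans _ _ (E_norm U phi * normA2 f)).
    by apply: normA2_mult_op_le => //; [exact: E_norm_ge0|apply/tr/E_norm_null].
  by rewrite ler_piMr// E_norm_ge0.
have ub : ubound [set normA2 (mult_op U p f) | f in [set f | normA2 f <= 1]]
    (E_norm U phi) by move=> _ [f /= f1 <-]; exact: Mle.
have in0 : [set f | normA2 f <= 1] (0 : A2 lam) by rewrite /= normA2_0.
have le_op f : normA2 f <= 1 -> normA2 (mult_op U p f) <= opnorm (mult_op U p).
  by move=> f1; apply: ub_le_sup; [exists (E_norm U phi)|exists f].
apply/eqP; rewrite eq_le; apply/andP; split.
  by apply: ge_sup ub; exists (normA2 (mult_op U p 0)), 0.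
have op0 : 0 <= opnorm (mult_op U p) := le_trans (normA2_ge0 _) (le_op _ in0).
by apply: E_norm_le => //; apply/tr/(opnorm_mult_op (U := U)).
Qed.

Lemma Linfty_lin (a : C) phi psi :
  Linfty U phi -> Linfty U psi -> Linfty U (a *: phi + psi).
Proof.
move=> /Linfty_borel_rep[p rp] /Linfty_borel_rep[q rq].
exact: borel_rep_Linfty (borel_rep_lin a rp rq).
Qed.

Lemma LinftyB phi psi : Linfty U phi -> Linfty U psi -> Linfty U (phi - psi).
Proof.
by move=> Lphi Lpsi; rewrite -[phi - psi]addrC -scaleN1r; exact: Linfty_lin.
Qed.

(* Outside of a Borel null set, Borel representatives of a Cauchy sequence
   converge uniformly. *)
Lemma Linfty_complete (u : nat -> R -> C) : (forall n, Linfty U (u n)) ->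
  (forall e : R, 0 < e -> exists n0 : nat, forall m n : nat,
    (n0 <= m)%N -> (n0 <= n)%N -> E_norm U (u m - u n) < e) ->
  exists2 phi, Linfty U phi & E_norm U (u n - phi) @[n --> \oo] --> (0 : R).
Proof.
move=> Lu cu.
have [p rp] := choice (fun n => Linfty_borel_rep (Lu n)).
pose bad m n := [set x | E_norm U (u m - u n) < normc (p m x - p n x)].
have nbad : half_line_null (\bigcup_m \bigcup_n bad m n).
  apply: half_line_null_bigcup => m; apply: half_line_null_bigcup => n.
  have [_ rm] := rp m; have [_ rn] := rp n.
  apply: half_line_nullS (half_line_nullU (E_norm_null (LinftyB (Lu m) (Lu n)))
    (half_line_nullU rm rn)) => x /= bx.
  apply: contrapT => /not_orP[+ /not_orP[/contrapT Em /contrapT En]]; apply.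
  by rewrite -[(u m - u n) x]/(u m x - u n x) Em En.
have [S [mS badS S0]] := (E_nullE U _).2 nbad.
have nS : half_line_null S by apply/(E_nullE U); exists S; split.
(* With the value 0 on S, the Cauchy estimate holds at every point, so pointwise limits exist
   everywhere and are Borel. *)
pose p' n : R -> C := (fun x => (\1_(~` S) x : R)%:C) * p n.
have p'B n : bounded_borel (p' n).
  apply: bounded_borelM; last exact: (rp n).1.
  by apply: bounded_borel_indic; exact: measurableC.
have p'S n x : ~ S x -> p' n x = p n x.
  by move=> Sx; rewrite /p' mulrfctE indicE mem_set// mul1r.
have p'le m n x : normc (p' m x - p' n x) <= E_norm U (u m - u n).
  have [Sx|Sx] := pselect (S x).
    rewrite /p' !mulrfctE indicE memNset; last by apply.
    by rewrite !mul0r subr0 Normc.normc0 E_norm_ge0.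
  rewrite !p'S// leNgt; apply/negP => lt; apply: Sx; apply: badS.
  by exists m => //; exists n.
have lim_part (part : C -> R) : (forall z w, part (z - w) = part z - part w) ->
    (forall z, `|part z| <= normc z) ->
    exists r : R -> R, (forall x, part (p' n x) @[n --> \oo] --> r x) /\
      forall (e : R) n0, (forall m n : nat,
        (n0 <= m)%N -> (n0 <= n)%N -> E_norm U (u m - u n) < e) ->
      forall n x, (n0 <= n)%N -> `|part (p' n x) - r x| <= e.
  move=> partB part_le.
  have cv x : cvg (part (p' n x) @[n --> \oo]).
    apply: cauchy_cvg; apply: cauchy_exP => e /= e0; have [n0 hn0] := cu e e0.
    exists (part (p' n0 x)); exists n0 => // n /= n0n.
    rewrite /ball /= -partB (le_lt_trans (part_le _))//.
    by rewrite (le_lt_trans (p'le _ _ _)) ?hn0.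
  exists (fun x => lim (part (p' n x) @[n --> \oo])); split => //.
  move=> e n0 hn0 n x n0n; apply/ler_addgt0Pr => d d0.
  have /cvgrPdist_lt/(_ d d0)[n1 _ hn1] := cv x.
  (* At this index the sequence is both within d of its limit at x and within e of its n-th term,
     uniformly in x. *)
  have := hn1 (maxn n0 n1) (leq_maxr _ _); rewrite distrC => hd.
  apply: (le_trans (ler_distD (part (p' (maxn n0 n1) x)) _ _)).
  apply: lerD; last exact: ltW.
  rewrite -partB (le_trans (part_le _))// (le_trans (p'le _ _ _))// ltW//.
  by apply: hn0 => //; exact: leq_maxl.
have [r [rcv rle]] := lim_part Re (fun z w => raddfB _ z w) (@normr_Re _).
have [s [scv sle]] := lim_part Im (fun z w => raddfB _ z w) (@normr_Im _).
pose q x : C := r x +i* s x.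
have qle (e : R) n0 : (forall m n : nat,
      (n0 <= m)%N -> (n0 <= n)%N -> E_norm U (u m - u n) < e) ->
    forall n x, (n0 <= n)%N -> normc (p' n x - q x) <= e + e.
  move=> hn0 n x n0n; rewrite (le_trans (normc_le _))// lerD//.
    by rewrite raddfB/=; exact: rle hn0 _ _ _.
  by rewrite raddfB/=; exact: sle hn0 _ _ _.
have qB : bounded_borel q.
  split.
    split.
      apply: (@measurable_fun_cvg _ _ _ _ (fun n x => Re (p' n x))) => //.
      by move=> n; have [[]] := p'B n.
    apply: (@measurable_fun_cvg _ _ _ _ (fun n x => Im (p' n x))) => //.
    by move=> n; have [[]] := p'B n.
  have [n0 hn0] := cu 1 ltr01; have [_ [M pM]] := p'B n0.
  exists (M + (1 + 1)) => x; rewrite -[q x](subrK (p' n0 x)) addrC.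
  rewrite (le_trans (ler_normcD _ _))// lerD// normcB.
  exact: qle hn0 _ _ (leqnn _).
exists q; first exact: borel_rep_Linfty (borel_rep_self qB).
(* The real and the imaginary part each contribute one half, as in [qle]. *)
apply/cvgrPdist_le => e e0; have e20 : 0 < e / 2 by rewrite divr_gt0.
have [n0 hn0] := cu _ e20; exists n0 => // n /= n0n.
rewrite sub0r normrN ger0_norm ?E_norm_ge0//.
apply: E_norm_le; first exact: ltW.
apply: half_line_nullS (half_line_nullU (rp n).2 nS) => x /=.
apply: contraPP => /not_orP[/contrapT E Sx] /=; apply/negP; rewrite -leNgt.
rewrite -[(u n - q) x]/(u n x - q x) E -p'S// (le_trans (qle _ _ hn0 _ _ n0n))//.
by rewrite -splitr.
Qed.

End FunctionalCalculusE.

(** * The C*-algebra of functions and its image *)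

Section Main.
Context {R : realType}.
Local Notation C := (R[i]).
Variables (lam : R) (U : spectral_rep lam).

Lemma LinftyM phi psi : Linfty U phi -> Linfty U psi -> Linfty U (phi * psi).
Proof.
move=> /Linfty_borel_rep[p rp] /Linfty_borel_rep[q rq].
exact: borel_rep_Linfty (borel_repM rp rq).
Qed.

Lemma Linfty_conj phi : Linfty U phi -> Linfty U (conjf phi).
Proof.
by move=> /Linfty_borel_rep[p rp]; exact: borel_rep_Linfty (borel_rep_conj rp).
Qed.

Lemma Linfty1 : Linfty U 1.
Proof. exact: borel_rep_Linfty (borel_rep_self (bounded_borel_cst 1)). Qed.

Lemma Linfty_Cstar : unital_Cstar_algebra (Linfty U) (E_ae_eq U) (E_norm U).
Proof.
have LZ (a : C) phi : Linfty U phi -> Linfty U (a *: phi).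
  have L0 : Linfty U 0 by exact: borel_rep_Linfty (borel_rep_self (bounded_borel_cst 0)).
  by move=> L; rewrite -[a *: phi]addr0; exact: Linfty_lin.
have NZ (a : C) phi : Linfty U phi -> E_norm U (a *: phi) <= normc a * E_norm U phi.
  move=> L; apply: E_norm_le; first by rewrite mulr_ge0 ?normc_ge0 ?E_norm_ge0.
  apply: half_line_nullS (E_norm_null L) => x /=.
  rewrite -[(a *: phi) x]/(a * phi x) Normc.normcM.
  by apply: contraTT; rewrite -!leNgt => h; rewrite ler_wpM2l ?normc_ge0.
split.
- exact: Linfty1.
- exact: Linfty_lin.
- exact: LinftyM.
- exact: Linfty_conj.
- by move=> phi _; exact: E_norm_ge0.
- move=> phi psi Lphi Lpsi; split=> [/E_nullE n|N0].
    apply/eqP; rewrite eq_le E_norm_ge0 andbT; apply: E_norm_le => //.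
    apply: half_line_nullS n => x /= + E; rewrite -[(phi - psi) x]/(phi x - psi x) E.
    by rewrite subrr Normc.normc0 ltxx.
  apply/E_nullE; apply: half_line_nullS (E_norm_null (LinftyB Lphi Lpsi)) => x /=.
  rewrite N0 => ne; rewrite lt_neqAle normc_ge0 andbT eq_sym; apply/eqP.
  by move=> /Normc.eq0_normc /eqP; rewrite subr_eq0 => /eqP.
- move=> a phi L; apply/eqP; rewrite eq_le NZ//=.
  have [->|a0] := eqVneq a 0; first by rewrite Normc.normc0 mul0r E_norm_ge0.
  have na0 : 0 < normc a.
    rewrite lt_neqAle normc_ge0 andbT eq_sym; apply: contra_neq a0.
    exact: Normc.eq0_normc.
  (* The reverse inequality is [NZ] for the inverse of a, applied to [a *: phi]. *)
  rewrite -ler_pdivlMl// -Normc.normcV (le_trans _ (NZ _ _ (LZ a _ L)))//.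
  by rewrite scalerA mulVf// scale1r.
- move=> phi psi Lphi Lpsi; apply: E_norm_le; first by rewrite addr_ge0 ?E_norm_ge0.
  apply: half_line_nullS
    (half_line_nullU (E_norm_null Lphi) (E_norm_null Lpsi)) => x /=.
  apply: contraPP => /not_orP[/negP + /negP]; rewrite -!leNgt => h1 h2.
  by apply/negP; rewrite -leNgt (le_trans (ler_normcD _ _))// lerD.
- move=> phi psi Lphi Lpsi; apply: E_norm_le; first by rewrite mulr_ge0 ?E_norm_ge0.
  apply: half_line_nullS
    (half_line_nullU (E_norm_null Lphi) (E_norm_null Lpsi)) => x /=.
  apply: contraPP => /not_orP[/negP + /negP]; rewrite -!leNgt => h1 h2.
  by apply/negP; rewrite -leNgt Normc.normcM ler_pM ?normc_ge0.
- move=> phi Lphi.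
  have nE x : normc ((conjf phi * phi) x) = normc (phi x) ^+ 2.
    by rewrite mulrfctE Normc.normcM normc_conj expr2.
  apply/eqP; rewrite eq_le; apply/andP; split.
    apply: E_norm_le; first exact: sqr_ge0.
    apply: half_line_nullS (E_norm_null Lphi) => x /=.
    by rewrite nE ltr_sqr ?nnegrE ?E_norm_ge0 ?normc_ge0.
  have LL := LinftyM (Linfty_conj Lphi) Lphi.
  (* The square root of the norm of |phi|^2 is an essential bound of phi. *)
  rewrite -[leRHS]sqr_sqrtr ?E_norm_ge0// ler_sqr ?nnegrE ?E_norm_ge0 ?sqrtr_ge0//.
  apply: E_norm_le; first exact: sqrtr_ge0.
  apply: half_line_nullS (E_norm_null LL) => x /=.
  rewrite nE -[X in X < _ ^+ 2]sqr_sqrtr ?E_norm_ge0//.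
  by rewrite ltr_sqr ?nnegrE ?sqrtr_ge0 ?normc_ge0.
- exact: Linfty_complete.
Qed.

Lemma funcK_isometric : isometric_star_isomorphism_on U (funcK U).
Proof.
split.
- by move=> phi /Linfty_borel_rep[p rp]; rewrite (funcK_mult_op U rp);
    apply: mult_op_bounded; exact: rp.1.
- move=> phi psi /Linfty_borel_rep[p rp] /Linfty_borel_rep[q rq].
  rewrite (funcK_mult_op U rp) (funcK_mult_op U rq); split=> [/E_nullE n|E].
    apply: mult_op_ae; [exact: rp.1|exact: rq.1|].
    apply: half_line_nullS (half_line_nullU n (half_line_nullU rp.2 rq.2)) => x /=.
    apply: contra_notP => /not_orP[/contrapT E /not_orP[/contrapT <- /contrapT <-]].
    exact: E.
  apply/E_nullE; have n := mult_op_inj rp.1 rq.1 E.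
  apply: half_line_nullS (half_line_nullU n (half_line_nullU rp.2 rq.2)) => x /=.
  by apply: contra_notP => /not_orP[/contrapT E' /not_orP[/contrapT -> /contrapT ->]].
- by rewrite (funcK_mult_op U (borel_rep_self (bounded_borel_cst 1))) -[RHS](mult_op1 U).
- move=> a phi psi /Linfty_borel_rep[p rp] /Linfty_borel_rep[q rq].
  rewrite (funcK_mult_op U rp) (funcK_mult_op U rq).
  rewrite (funcK_mult_op U (borel_rep_lin a rp rq)).
  by apply: mult_op_lin; [exact: rp.1|exact: rq.1].
- move=> phi psi /Linfty_borel_rep[p rp] /Linfty_borel_rep[q rq].
  rewrite (funcK_mult_op U rp) (funcK_mult_op U rq).
  rewrite (funcK_mult_op U (borel_repM rp rq)).
  by apply: mult_op_mul; [exact: rp.1|exact: rq.1].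
- move=> phi /Linfty_borel_rep[p rp].
  rewrite (funcK_mult_op U rp) (funcK_mult_op U (borel_rep_conj rp)).
  by apply: mult_op_adj; exact: rp.1.
- move=> phi L; have [p rp] := Linfty_borel_rep L.
  by rewrite (funcK_mult_op U rp); exact: opnorm_mult_opE.
Qed.

Lemma funcK_subalgebra :
  commutative_unital_star_subalgebra [set funcK U phi | phi in Linfty U].
Proof.
have [bd _ one lin mul conj _] := funcK_isometric.
split.
- by move=> _ [phi L <-]; exact: bd.
- by exists 1; [exact: Linfty1|exact: one].
- move=> a _ _ [phi L <-] [psi L' <-]; exists (a *: phi + psi).
    exact: Linfty_lin.
  exact: lin.
- move=> _ _ [phi L <-] [psi L' <-]; exists (phi * psi); first exact: LinftyM.
  exact: mul.
- move=> _ _ [phi L <-] [psi L' <-].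
  rewrite -(mul phi psi L L') -(mul psi phi L' L).
  by congr (funcK U _); exact: mulrC.
- move=> _ [phi L <-]; exists (funcK U (conjf phi)); last exact: conj.
  by exists (conjf phi); [exact: Linfty_conj|exact: erefl].
Qed.

End Main.

Theorem proposition4p2 (R : realType) (lam : R) (hlam : -1 < lam)
    (U : spectral_rep lam) :
  [/\ unital_Cstar_algebra (Linfty U) (E_ae_eq U) (E_norm U),
      isometric_star_isomorphism_on U (funcK U) &
      commutative_unital_star_subalgebra [set funcK U phi | phi in Linfty U]].
Proof.
split; [exact: Linfty_Cstar|exact: funcK_isometric|exact: funcK_subalgebra].
Qed.
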